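(* Let $X_1,\dots,X_n\in\mathbb{R}^p$ be i.i.d. and $Y_1,\dots,Y_n\in\mathbb{R}^p$ be i.i.d., satisfying the standing assumptions listed in the context. Let $D$ be a deterministic $n\times n$ diagonal matrix with positive diagonal entries $R_1,\dots,R_n$, and let $A$ be a deterministic positive definite $p\times p$ matrix with $A\succeq t\,\mathrm{Id}_p$ for some $t>0$. For a deterministic vector $\alpha\in\mathbb{R}^n$ with $\|\alpha\|=1$ let $$g(\alpha;X)=\alpha^\top\frac{DX}{\sqrt n}\left(\frac{X^\top D^2X}{n}+A\right)^{-1}\frac{X^\top D}{\sqrt n}\alpha ,$$ and define $g(\alpha;Y)$ in the same way with $Y$ in place of $X$. Then $$\left|\mathbb{E}[g(\alpha;X)-g(\alpha;Y)]\right|\le\sum_{i=1}^n\big(U(X_i;R_i;\alpha_i)+U(Y_i;R_i;\alpha_i)\big),$$ where $U(X_i;R_i;\alpha_i)$ and $U(Y_i;R_i;\alpha_i)$ are deterministic quantities which depend on the random vectors only through the distribution of $X_i$, respectively $Y_i$, and there is a numerical constant $K$, not depending on the distributions of the $X_i$ and $Y_i$ nor on $n$ or $p$, such that $$\sum_{i=1}^nU(X_i;R_i;\alpha_i)\le K\sum_{i=1}^n\left(\frac{R_i^2}{\sqrt n\,t}\sqrt{\frac{b_{Q_2}(2;X_i)}{n}}\wedge1\right)\left(\alpha_i^2+\frac{R_i^2}{nt}\sqrt{b_L(4;X_i)}\right),$$ and likewise with $Y_i$ in place of $X_i$.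
   Context: Notation: $X$ (resp. $Y$) is the $n\times p$ matrix whose $i$-th row is $X_i^\top$ (resp. $Y_i^\top$). $a\wedge b=\min(a,b)$; $\succeq$ is the Loewner order; $\|\cdot\|_{op}$ is the operator norm; $\|\alpha\|$ is the Euclidean norm. Standing assumptions: the ratio $p/n$ stays bounded away from $0$ and $\infty$; the $X_j$ are independent, the $Y_j$ are independent, and the $Y_j$'s are independent of the $X_j$'s; for each $j$, $X_j$ and $Y_j$ have mean $0$ and the same covariance matrix $\Sigma_j$. For $Z\in\{X_j,Y_j\}$ and $k\ge1$, $b_L(k;Z)$ and $b_{Q_2}(k;Z)$ are deterministic numbers (finite for the exponents that appear) such that $\mathbb{E}|Z^\top v|^k\le b_L(k;Z)$ for every deterministic unit vector $v$, and $\mathbb{E}|Z^\top MZ-\mathbb{E}[Z^\top MZ]|^k\le b_{Q_2}(k;Z)$ for every deterministic positive semidefinite $M$ with $\|M\|_{op}\le1$. Without loss of generality $b_L(k;Z)\le\sqrt{b_L(2k;Z)}$. *)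

(* Defs.v *)
From HB Require Import structures.
From mathcomp Require Import all_boot all_order all_algebra.
From mathcomp Require Import all_classical all_reals all_analysis.

Set Implicit Arguments.
Unset Strict Implicit.
Unset Printing Implicit Defensive.
Import Order.TTheory GRing.Theory Num.Theory.
Local Open Scope classical_set_scope.
Local Open Scope ring_scope.

Definition is_psd (R : realType) (m : nat) (M : 'M[R]_m) : Prop :=
  M^T = M /\ forall v : 'cV[R]_m, 0 <= (v^T *m M *m v) 0 0.

Definition is_posdef (R : realType) (m : nat) (M : 'M[R]_m) : Prop :=
  M^T = M /\ forall v : 'cV[R]_m, v != 0 -> 0 < (v^T *m M *m v) 0 0.

Definition loewner_ge (R : realType) (m : nat) (M N : 'M[R]_m) : Prop :=
  is_psd (M - N).

(* The library norm on matrices is the sup norm, hence this definition. *)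
Definition enorm (R : realType) (m : nat) (v : 'cV[R]_m) : R :=
  Num.sqrt (\sum_i v i 0 ^+ 2).

Definition opnorm (R : realType) (m : nat) (M : 'M[R]_m) : R :=
  sup [set enorm (M *m v) | v in [set v : 'cV[R]_m | enorm v <= 1]].

Definition vec (R : realType) (p : nat) (z : p.-tuple R) : 'cV[R]_p :=
  \col_j tnth z j.

Definition rows_mx (R : realType) (n p : nat) (z : 'I_n -> p.-tuple R) :
    'M[R]_(n, p) :=
  \matrix_(i, j) tnth (z i) j.

Definition g (R : realType) (n p : nat) (D : 'M[R]_n) (A : 'M[R]_p)
    (alpha : 'cV[R]_n) (X : 'M[R]_(n, p)) : R :=
  (alpha^T *m ((Num.sqrt n%:R)^-1 *: (D *m X))
     *m invmx (n%:R^-1 *: (X^T *m (D *m D) *m X) + A)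
     *m ((Num.sqrt n%:R)^-1 *: (X^T *m D)) *m alpha) 0 0.

Definition independent_RVs d d' (T : measurableType d) (S : measurableType d')
    (R : realType) (P : probability T R) (n : nat)
    (Z : 'I_n -> {RV P >-> S}) : Prop :=
  forall (J : {set 'I_n}) (B : 'I_n -> set S),
    (forall i, i \in J -> measurable (B i)) ->
    P (\bigcap_(i in [set` J]) (Z i @^-1` B i)) =
      (\prod_(i in J) P (Z i @^-1` B i))%E.

(* [g_sigma_preimage Z] is the sigma-algebra generated by the whole family Z. *)
Definition independent_families d d' (T : measurableType d)
    (S : measurableType d') (R : realType) (P : probability T R) (n : nat)
    (Z W : 'I_n -> {RV P >-> S}) : Prop :=
  forall E F : set T,
    g_sigma_preimage (fun i => Z i : T -> S) E ->
    g_sigma_preimage (fun i => W i : T -> S) F ->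
    P (E `&` F) = (P E * P F)%E.

(* Two probabilities are compared on measurable sets only: their values on
   other sets carry no meaning. *)
Definition same_law d (S : measurableType d) (R : realType)
    (mu nu : probability S R) : Prop :=
  forall B : set S, measurable B -> mu B = nu B.

Definition identically_distributed d d' (T : measurableType d)
    (S : measurableType d') (R : realType) (P : probability T R) (n : nat)
    (Z : 'I_n -> {RV P >-> S}) : Prop :=
  forall i j, same_law (distribution P (Z i)) (distribution P (Z j)).

Definition mean_zero d (T : measurableType d) (R : realType)
    (P : probability T R) (p : nat) (Z : {RV P >-> p.-tuple R}) : Prop :=
  forall a : 'I_p, ('E_P[fun w => tnth (Z w) a] = 0)%E.

Definition has_covariance d (T : measurableType d) (R : realType)
    (P : probability T R) (p : nat) (Z : {RV P >-> p.-tuple R})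
    (Sigma : 'M[R]_p) : Prop :=
  forall a b : 'I_p,
    covariance P (fun w => tnth (Z w) a) (fun w => tnth (Z w) b) =
      (Sigma a b)%:E.

Definition linear_form (R : realType) (p : nat) (v : 'cV[R]_p)
    (z : p.-tuple R) : R :=
  ((vec z)^T *m v) 0 0.

Definition quadratic_form (R : realType) (p : nat) (M : 'M[R]_p)
    (z : p.-tuple R) : R :=
  ((vec z)^T *m M *m vec z) 0 0.

(* bL k and bQ2 k bound the k-th moments. They are extended reals, as only the
   exponents that are used need finite bounds. The mean of the quadratic form is
   finite as soon as bL 4 is, so that [fine] loses nothing then. *)
Definition moment_bounds d (T : measurableType d) (R : realType)
    (P : probability T R) (p : nat) (Z : {RV P >-> p.-tuple R})
    (bL bQ2 : nat -> \bar R) : Prop :=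
  [/\ forall (k : nat) (v : 'cV[R]_p), (1 <= k)%N -> enorm v = 1 ->
        ('E_P[fun w => (`|linear_form v (Z w)| ^+ k)%R] <= bL k)%E,
      forall (k : nat) (M : 'M[R]_p), (1 <= k)%N -> is_psd M ->
        opnorm M <= 1 ->
        ('E_P[fun w => (`|quadratic_form M (Z w) -
             fine 'E_P[fun w' => quadratic_form M (Z w')]| ^+ k)%R]
           <= bQ2 k)%E &
      forall k : nat, (1 <= k)%N -> (bL k <= sqrte (bL (2 * k)%N))%E ].

(* The i-th summand of the bound on the sum of the U's, for the values bL4 and
   bQ22 of b_L(4; Z) and b_{Q_2}(2; Z). *)
Definition bound_term (R : realType) (n : nat) (t r a : R)
    (bL4 bQ22 : \bar R) : R :=
  Num.min (r ^+ 2 / (Num.sqrt n%:R * t) * Num.sqrt (fine bQ22 / n%:R)) 1 *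
  (a ^+ 2 + r ^+ 2 / (n%:R * t) * Num.sqrt (fine bL4)).

(* Main.v *)
From HB Require Import structures.
Require Import Defs.
From mathcomp Require Import all_boot all_order all_algebra.
From mathcomp Require Import all_classical all_reals all_analysis.
From mathcomp Require Import measurable_realfun.
From mathcomp Require Import ring lra.
Import Order.TTheory GRing.Theory Num.Theory.
Local Open Scope classical_set_scope.
Local Open Scope ring_scope.
Set Implicit Arguments.
Unset Strict Implicit.
Unset Printing Implicit Defensive.

(** Write [s = r_i / sqrt n], and isolate the row [z] of index [i]. With [V0]
    the scaled data in which that row is zero, [G] the inverse of
    [V0^T V0 + A], [y = G V0^T alpha] and [a = alpha_i], the Sherman-Morrison
    identity gives
      [g = b - (a - s <y, z>)^2 / (1 + s^2 <z, G z>)]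
    where [b] does not depend on [z] ([rank_one_update], [g_set_row]). The
    resolvent is controlled by [A >= t]: [t G] is positive semidefinite of
    operator norm at most 1, and [t |y|^2 <= |alpha|^2 = 1].

    Let [z] be random and the other rows be fixed. If the quadratic form in the
    denominator is replaced by its mean, the fraction becomes a polynomial of
    degree two in [z], whose mean only involves the covariance of [z]; it is
    the same for a row of [X] and for the row of [Y] of the same index. The
    map [q |-> 1 / (1 + q)] is 1-Lipschitz with values in an interval of length
    1, so the replacement costs at most the mean of
      [(2 a^2 + 2 s^2 <y, z>^2) * min(|q - E q|, 1)],  [q = s^2 <z, G z>].
    The variance bound on quadratic forms and the fourth moment bound on linear
    forms estimate this by Cauchy-Schwarz ([one_row_estimate]); the result is
    twice the summand of the announced bound.

    The comparison of the two matrices is Lindeberg's: rows of [Y] are replaced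
    by rows of [X] one at a time. A mixture of rows of [X] and [Y] is again
    independent ([independent_choice]), so that by Fubini the row being replaced
    can be integrated out first, the others being fixed
    ([integral_independent_row]), which is the situation above
    ([lindeberg_step]).

    To make the errors depend on the law of a row only, they are formed with
    the best constants in the two moment bounds, which are suprema of integrals
    against that law; the given constants are at least as large
    ([row_moments_distribution]). *)

(** * Inner products and coercive matrices *)

Definition dot (R : realType) (m : nat) (u v : 'cV[R]_m) : R := (u^T *m v) 0 0.

Lemma dotC (R : realType) m (u v : 'cV[R]_m) : dot u v = dot v u.
Proof. by rewrite /dot !mxE; apply: eq_bigr => i _; rewrite !mxE mulrC. Qed.

Lemma dotDl (R : realType) m (u v w : 'cV[R]_m) :
  dot (u + v) w = dot u w + dot v w.
Proof. by rewrite /dot linearD/= mulmxDl mxE. Qed.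

Lemma dotDr (R : realType) m (u v w : 'cV[R]_m) :
  dot w (u + v) = dot w u + dot w v.
Proof. by rewrite /dot mulmxDr mxE. Qed.

Lemma dotZl (R : realType) m (c : R) (u v : 'cV[R]_m) :
  dot (c *: u) v = c * dot u v.
Proof. by rewrite /dot linearZ/= -scalemxAl mxE. Qed.

Lemma dotZr (R : realType) m (c : R) (u v : 'cV[R]_m) :
  dot u (c *: v) = c * dot u v.
Proof. by rewrite /dot -scalemxAr mxE. Qed.

Lemma dot_mulmxr (R : realType) m k (M : 'M[R]_(m, k)) u v :
  dot u (M *m v) = dot (M^T *m u) v.
Proof. by rewrite /dot trmx_mul trmxK mulmxA. Qed.

Lemma dot_sqr_ge0 (R : realType) m (u : 'cV[R]_m) : 0 <= dot u u.
Proof. by rewrite /dot mxE sumr_ge0// => i _; rewrite mxE -expr2 sqr_ge0. Qed.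

Lemma dot_sqr_eq0 (R : realType) m (u : 'cV[R]_m) : (dot u u == 0) = (u == 0).
Proof.
apply/idP/idP => [|/eqP->]; last by rewrite /dot mulmx0 mxE.
rewrite /dot mxE psumr_eq0 => [/allP u0|i _]; last by rewrite mxE -expr2 sqr_ge0.
apply/eqP/matrixP => i j; rewrite ord1 !mxE; apply/eqP.
by have := u0 i (mem_index_enum _); rewrite mxE -expr2 sqrf_eq0.
Qed.

Lemma enormE (R : realType) m (u : 'cV[R]_m) : enorm u = Num.sqrt (dot u u).
Proof.
by rewrite /enorm /dot mxE; congr Num.sqrt; apply: eq_bigr => i _; rewrite mxE.
Qed.

(** For two vectors this is the inequality between the geometric and the
    arithmetic mean; it stands in for Cauchy-Schwarz in the two norm bounds
    on the resolvent. *)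
Lemma dot_amgm (R : realType) m (u v : 'cV[R]_m) :
  2 * dot u v <= dot u u + dot v v.
Proof.
have := dot_sqr_ge0 (u - v).
rewrite -scaleN1r !dotDl !dotDr !dotZl !dotZr (dotC v u); lra.
Qed.

(** The part of positive definiteness together with [S >= t] that is stable
    under adding a Gram matrix and that bounds the inverse. *)
Definition coercive (R : realType) m (t : R) (S : 'M[R]_m) : Prop :=
  S^T = S /\ forall x, t * dot x x <= dot x (S *m x).

Lemma coercive_unitmx (R : realType) m (t : R) (S : 'M[R]_m) :
  0 < t -> coercive t S -> S \in unitmx.
Proof.
move=> t0 [ST cS]; rewrite -row_free_unit -kermx_eq0.
apply/rowV0P => v /sub_kermxP vS.
have {}vS : S *m v^T = 0 by rewrite -[S]trmxK ST -trmx_mul vS trmx0.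
have := cS v^T; rewrite vS {2}/dot mulmx0 mxE => v0.
have : dot v^T v^T == 0.
  by rewrite eq_le dot_sqr_ge0 andbT -(pmulr_rle0 _ t0).
by rewrite dot_sqr_eq0 => /eqP vT0; rewrite -[v]trmxK vT0 trmx0.
Qed.

Lemma coercive_gram (R : realType) n p (t : R) (V : 'M[R]_(n, p)) A :
  coercive t A -> coercive t (V^T *m V + A).
Proof.
move=> [AT cA]; split; first by rewrite linearD/= trmx_mul trmxK AT.
move=> x; rewrite mulmxDl dotDr -mulmxA dot_mulmxr trmxK.
by have := cA x; have := dot_sqr_ge0 (V *m x); lra.
Qed.

Lemma loewner_coercive (R : realType) p (t : R) (A : 'M[R]_p) :
  is_posdef A -> loewner_ge A t%:M -> coercive t A.
Proof.
move=> [AT _] [_ At]; split=> // x; have := At x.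
rewrite -mulmxA -/(dot x _) mulmxBl mul_scalar_mx -scaleN1r dotDr !dotZr; lra.
Qed.

Lemma coercive_inv_sym (R : realType) m (t : R) (S : 'M[R]_m) :
  coercive t S -> (invmx S)^T = invmx S.
Proof. by move=> [ST _]; rewrite trmx_inv ST. Qed.

(** The point where the lower bound on [S] becomes an upper bound on its
    inverse: test coercivity at [invmx S *m x]. *)
Lemma coercive_inv (R : realType) m (t : R) (S : 'M[R]_m) (x : 'cV[R]_m) :
  0 < t -> coercive t S ->
  t * dot (invmx S *m x) (invmx S *m x) <= dot x (invmx S *m x).
Proof.
move=> t0 cS; have [_] := cS; move=> /(_ (invmx S *m x)).
by rewrite mulKVmx ?(coercive_unitmx t0 cS)// (dotC _ x).
Qed.

Lemma coercive_inv_psd (R : realType) m (t : R) (S : 'M[R]_m) :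
  0 < t -> coercive t S -> is_psd (t *: invmx S).
Proof.
move=> t0 cS; split; first by rewrite linearZ/= (coercive_inv_sym cS).
move=> v; rewrite -mulmxA -/(dot v _) -scalemxAl dotZr mulr_ge0 ?(ltW t0)//.
by rewrite (le_trans _ (coercive_inv v t0 cS))// mulr_ge0 ?dot_sqr_ge0// ltW.
Qed.

(** If [y] is the image of [v] by the inverse, [coercive_inv] gives
    [t * dot y y <= dot v y], and [dot_amgm] for [v] and [t *: y] turns this
    into the comparison of the two norms. *)
Lemma coercive_inv_opnorm (R : realType) m (t : R) (S : 'M[R]_m) :
  0 < t -> coercive t S -> opnorm (t *: invmx S) <= 1.
Proof.
move=> t0 cS; apply: ge_sup.
  exists (enorm (t *: invmx S *m 0)); exists 0 => //=.
  by rewrite enormE /dot mulmx0 mxE sqrtr0.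
move=> _ [v /= v1 <-]; rewrite (le_trans _ v1)// !enormE; apply: ler_wsqrtr.
rewrite -scalemxAl dotZl dotZr.
set y := invmx S *m v.
have /(ler_wpM2l (ltW t0)) := coercive_inv v t0 cS; rewrite -/y => h1.
have := dot_amgm v (t *: y); rewrite dotZl !dotZr; lra.
Qed.

(** * The functional [g] and rank-one changes *)

(** [g] with the scaling absorbed in the data matrix. *)
Definition ridge (R : realType) n p (A : 'M[R]_p) (alpha : 'cV[R]_n)
    (V : 'M[R]_(n, p)) : R :=
  dot (V^T *m alpha) (invmx (V^T *m V + A) *m (V^T *m alpha)).

Lemma g_ridge (R : realType) n p (r : 'rV[R]_n) (A : 'M[R]_p) alpha X :
  g (diag_mx r) A alpha X =
  ridge A alpha ((Num.sqrt n%:R)^-1 *: (diag_mx r *m X)).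
Proof.
rewrite /g /ridge /dot; set c := (_)^-1; congr (fun_of_matrix _ 0 0).
have VT : (c *: (diag_mx r *m X))^T = c *: (X^T *m diag_mx r).
  by rewrite linearZ/= trmx_mul tr_diag_mx.
have -> : n%:R^-1 *: (X^T *m (diag_mx r *m diag_mx r) *m X) =
    (c *: (diag_mx r *m X))^T *m (c *: (diag_mx r *m X)).
  rewrite VT -scalemxAr -scalemxAl scalerA -invfM -expr2 sqr_sqrtr ?ler0n//.
  by rewrite !mulmxA.
rewrite -VT trmx_mul trmxK.
by rewrite !mulmxA.
Qed.

(** With [y] the solution of the linear system, [ridge] equals both
    [dot alpha (V *m y)] and [dot (V *m y) (V *m y) + dot y (A *m y)]; the upper
    bound follows by [dot_amgm]. *)
Lemma ridge_bounds (R : realType) n p (t : R) (A : 'M[R]_p) alpha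
    (V : 'M[R]_(n, p)) :
  0 < t -> coercive t A ->
  let y := invmx (V^T *m V + A) *m (V^T *m alpha) in
  t * dot y y <= ridge A alpha V /\ ridge A alpha V <= dot alpha alpha.
Proof.
move=> t0 cA y; have cS := coercive_gram V cA.
split; first exact: coercive_inv.
have [_ /(_ y)] := cA => yA.
have e1 : ridge A alpha V = dot y ((V^T *m V + A) *m y).
  by rewrite /ridge -/y mulKVmx ?(coercive_unitmx t0 cS)// dotC.
have e2 : ridge A alpha V = dot alpha (V *m y).
  by rewrite /ridge -/y dot_mulmxr.
rewrite mulmxDl dotDr -mulmxA dot_mulmxr trmxK in e1.
have := dot_amgm alpha (V *m y).
have : 0 <= t * dot y y by rewrite mulr_ge0 ?dot_sqr_ge0// ltW.
lra.
Qed.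

(** Sherman-Morrison, applied to the whole value rather than to the inverse:
    an explicit vector solves the perturbed system, hence is the image of the
    right-hand side by the inverse. That [u] and the matrix are perturbed along
    the same [w] is what lets the terms recombine into one square. *)
Lemma rank_one_update (R : realType) m (S : 'M[R]_m) (u w : 'cV[R]_m) (a : R) :
  let G := invmx S in
  S \in unitmx -> S + w *m w^T \in unitmx -> G^T = G ->
  0 <= dot w (G *m w) ->
  dot (u + a *: w) (invmx (S + w *m w^T) *m (u + a *: w)) =
  dot u (G *m u) + a ^+ 2
  - (a - dot (G *m u) w) ^+ 2 / (1 + dot w (G *m w)).
Proof.
move=> G uS uS' GT q0.
set q := dot w (G *m w) in q0 *; set u' := u + a *: w.
have q1 : 1 + q != 0 by rewrite gt_eqF// ltr_pwDl.
pose kappa := dot w (G *m u') / (1 + q).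
have kE : dot w (G *m u') = kappa * (1 + q) by rewrite /kappa divfK.
have kE' : kappa = dot w (G *m u') / (1 + q) by [].
clearbody kappa.
have ww x : w *m w^T *m x = dot w x *: w.
  rewrite -mulmxA /dot; move: (w^T *m x) => M.
  by rewrite [M]mx11_scalar mul_mx_scalar !mxE.
have -> : invmx (S + w *m w^T) *m u' = G *m u' - kappa *: (G *m w).
  apply: (can_inj (mulKmx uS')); rewrite mulKVmx// mulmxDl ww mulmxBr.
  rewrite -scalemxAr !mulKVmx// -!scaleNr dotDr dotZr -/q.
  rewrite kE -addrA -scalerDl.
  by rewrite (_ : - kappa + _ = 0) ?scale0r ?addr0//; ring.
have b1 : dot w (G *m u) = dot (G *m u) w by rewrite dotC.
have b2 : dot u (G *m w) = dot (G *m u) w by rewrite dot_mulmxr GT.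
rewrite -scaleNr dotDr dotZr kE' /u' !mulmxDr -!scalemxAr.
rewrite !dotDr !dotDl !dotZl !dotZr b1 b2 -/q.
by field.
Qed.

(** * Linear and quadratic forms *)

Lemma measurable_funV d (T : measurableType d) (R : realType) (f : T -> R) :
  measurable_fun setT f -> measurable_fun setT (fun x => (f x)^-1).
Proof.
move=> mf.
(* Real powers are measurable, and [x^-1 = x * (x ^+ 2)^-1] holds for [x = 0]
   too. *)
have -> : (fun x => (f x)^-1) = (fun x => f x * (f x ^+ 2) `^ (-1)).
  apply/funext => x; rewrite powR_inv1 ?sqr_ge0//.
  have [->|fx0] := eqVneq (f x) 0; first by rewrite invr0 mul0r.
  by rewrite expr2 invfM mulrA divff// mul1r.
apply: measurable_funM => //.
apply: (@measurableT_comp _ _ _ _ _ _ (@powR R ^~ (-1)) _ (fun x => f x ^+ 2)).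
  exact: measurable_powR.
exact: measurable_funX.
Qed.

Lemma measurable_linear_form (R : realType) p (v : 'cV[R]_p) :
  measurable_fun setT (linear_form v).
Proof.
rewrite (_ : linear_form v = fun z => \sum_i tnth z i * v i 0).
  by apply: measurable_sum => i; apply: measurable_funM => //; exact: measurable_tnth.
by apply/funext => z; rewrite /linear_form mxE; apply: eq_bigr => i _; rewrite !mxE.
Qed.

Lemma quadratic_formE (R : realType) p (M : 'M[R]_p) z :
  quadratic_form M z = \sum_i \sum_j M i j * (tnth z i * tnth z j).
Proof.
rewrite /quadratic_form mxE exchange_big; apply: eq_bigr => j _ /=.
rewrite !mxE big_distrl; apply: eq_bigr => i _ /=; rewrite !mxE; ring.
Qed.

Lemma linear_formE (R : realType) p (v : 'cV[R]_p) z :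
  linear_form v z = \sum_i v i 0 * tnth z i.
Proof.
by rewrite /linear_form mxE; apply: eq_bigr => i _; rewrite !mxE mulrC.
Qed.

Lemma measurable_quadratic_form (R : realType) p (M : 'M[R]_p) :
  measurable_fun setT (quadratic_form M).
Proof.
rewrite (funext (quadratic_formE M)).
apply: measurable_sum => i; apply: measurable_sum => j.
by do 2! apply: measurable_funM => //; exact: measurable_tnth.
Qed.

(** * The Cauchy-Schwarz inequality *)

Lemma integral_sqrD_le d (T : measurableType d) (R : realType)
    (mu : probability T R) (f h : T -> R) (F H lambda : R) :
  measurable_fun setT f -> measurable_fun setT h -> 0 < lambda ->
  (\int[mu]_x (f x ^+ 2)%:E <= F%:E)%E -> (\int[mu]_x (h x ^+ 2)%:E <= H%:E)%E ->
  (\int[mu]_x (lambda^-1 / 2 * f x ^+ 2 + lambda / 2 * h x ^+ 2)%:E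
   <= (lambda^-1 / 2 * F + lambda / 2 * H)%:E)%E.
Proof.
move=> mf mh l0 fF hH.
have li0 : 0 <= lambda^-1 / 2 by rewrite divr_ge0 ?invr_ge0 ?ltW.
have l20 : 0 <= lambda / 2 by rewrite divr_ge0 ?ltW.
under eq_integral do rewrite EFinD (EFinM (lambda^-1 / 2)) (EFinM (lambda / 2)).
have mf2 : measurable_fun setT (fun x => (f x ^+ 2)%:E).
  by apply/measurable_EFinP; exact: measurable_funX.
have mh2 : measurable_fun setT (fun x => (h x ^+ 2)%:E).
  by apply/measurable_EFinP; exact: measurable_funX.
have f20 x : (0 <= (f x ^+ 2)%:E)%E by rewrite lee_fin sqr_ge0.
have h20 x : (0 <= (h x ^+ 2)%:E)%E by rewrite lee_fin sqr_ge0.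
rewrite ge0_integralD//=.
- rewrite !ge0_integralZl_EFin//.
  rewrite EFinD (EFinM (lambda^-1 / 2)) (EFinM (lambda / 2)).
  by apply: leeD; apply: lee_pmul => //; apply: integral_ge0.
- by move=> x _; rewrite -EFinM lee_fin mulr_ge0 ?sqr_ge0.
- under eq_fun do rewrite -EFinM.
  by apply/measurable_EFinP/measurable_funM => //; exact: measurable_funX.
- by move=> x _; rewrite -EFinM lee_fin mulr_ge0 ?sqr_ge0.
- under eq_fun do rewrite -EFinM.
  by apply/measurable_EFinP/measurable_funM => //; exact: measurable_funX.
Qed.

(** Cauchy-Schwarz with bounds in place of the norms. The weighted mean
    inequality is used with the ratio of the bounds as weight; both bounds are
    first enlarged so that this ratio makes sense when one of them vanishes. *)
Lemma integral_cauchy_schwarz d (T : measurableType d) (R : realType)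
    (mu : probability T R) (f h : T -> R) (F H : R) :
  measurable_fun setT f -> measurable_fun setT h ->
  (forall x, 0 <= f x) -> (forall x, 0 <= h x) -> 0 <= F -> 0 <= H ->
  (\int[mu]_x (f x ^+ 2)%:E <= (F ^+ 2)%:E)%E ->
  (\int[mu]_x (h x ^+ 2)%:E <= (H ^+ 2)%:E)%E ->
  (\int[mu]_x (f x * h x)%:E <= (F * H)%:E)%E.
Proof.
move=> mf mh f0 h0 F0 H0 fF hH.
have key e : 0 < e -> (\int[mu]_x (f x * h x)%:E <= ((F + e) * (H + e))%:E)%E.
  move=> e0; have Fe : 0 < F + e by rewrite ltr_wpDl.
  have He : 0 < H + e by rewrite ltr_wpDl.
  set l := (F + e) / (H + e).
  have l0 : 0 < l by rewrite divr_gt0.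
  apply: (@le_trans _ _ (\int[mu]_x (l^-1 / 2 * f x ^+ 2 + l / 2 * h x ^+ 2)%:E)%E).
    apply: ge0_le_integral => //.
    - by move=> x _; rewrite lee_fin mulr_ge0.
    - by apply/measurable_EFinP/measurable_funM.
    - by apply/measurable_EFinP; apply: measurable_funD; apply: measurable_funM => //;
         exact: measurable_funX.
    move=> x _; rewrite lee_fin -subr_ge0.
    have -> : l^-1 / 2 * f x ^+ 2 + l / 2 * h x ^+ 2 - f x * h x =
      l^-1 / 2 * (f x - l * h x) ^+ 2 by field; rewrite gt_eqF.
    by rewrite mulr_ge0 ?sqr_ge0// divr_ge0 ?invr_ge0 ?ltW.
  apply: (le_trans (integral_sqrD_le mf mh l0 fF hH)); rewrite lee_fin.
  have F2 : F ^+ 2 <= (F + e) ^+ 2 by nra.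
  have H2 : H ^+ 2 <= (H + e) ^+ 2 by nra.
  apply: (@le_trans _ _ (l^-1 / 2 * (F + e) ^+ 2 + l / 2 * (H + e) ^+ 2)).
    by apply: lerD; apply: ler_wpM2l => //; rewrite divr_ge0 ?invr_ge0 ?ltW.
  by rewrite /l le_eqVlt; apply/orP; left; apply/eqP; field; rewrite (gt_eqF Fe) (gt_eqF He).
apply/lee_addgt0Pr => e e0.
pose dl := Num.min 1 (e / (F + H + 1)).
have FH : 0 < F + H + 1 by rewrite ltr_wpDl// addr_ge0.
have d0 : 0 < dl by rewrite lt_min ltr01 divr_gt0.
have d1 : dl <= 1 by rewrite /dl ge_min lexx.
have d2 : dl * (F + H + 1) <= e by rewrite -ler_pdivlMr// /dl ge_min lexx orbT.
apply: (le_trans (key _ d0)); rewrite -EFinD lee_fin.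
nra.
Qed.

(** * Moments of one row *)

Lemma integrable_le_EFin d (T : measurableType d) (R : realType)
    (mu : probability T R) (f h : T -> R) :
  measurable_fun setT f -> (forall x, `|f x| <= h x) ->
  mu.-integrable setT (EFin \o h) -> mu.-integrable setT (EFin \o f).
Proof.
move=> mf fh; apply: le_integrable => //; first exact/measurable_EFinP.
by move=> x _ /=; rewrite lee_fin (le_trans (fh x))// ler_norm.
Qed.

Lemma integrable_cstr d (T : measurableType d) (R : realType)
    (mu : probability T R) (c : R) : mu.-integrable setT (EFin \o cst c).
Proof.
exact: finite_measure_integrable_cst.
Qed.

(** The hypotheses only bound fourth moments; this is how the first and second
    moments are known to exist. *)
Lemma integrable_mul_fourth d (T : measurableType d) (R : realType)
    (mu : probability T R) (f h : T -> R) :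
  measurable_fun setT f -> measurable_fun setT h ->
  (\int[mu]_x (`|f x| ^+ 4)%:E < +oo)%E -> (\int[mu]_x (`|h x| ^+ 4)%:E < +oo)%E ->
  mu.-integrable setT (EFin \o (fun x => f x * h x)).
Proof.
move=> mf mh f4 h4.
have i4 (k : T -> R) : measurable_fun setT k -> (\int[mu]_x (`|k x| ^+ 4)%:E < +oo)%E ->
    mu.-integrable setT (EFin \o (fun x => `|k x| ^+ 4)).
  move=> mk k4; apply/integrableP; split.
    by apply/measurable_EFinP/measurable_funX; exact: measurableT_comp.
  by under eq_integral do rewrite /= ger0_norm ?exprn_ge0//.
apply: (@integrable_le_EFin _ _ _ _ _
  (fun x => 1 + (`|f x| ^+ 4 + `|h x| ^+ 4))).
- exact: measurable_funM.
- move=> x; rewrite normrM; move: `|f x| `|h x| => a b.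
  (* 2ab <= a^2 + b^2, and 2c^2 <= 1 + c^4 for c = a and c = b *)
  have h1 := sqr_ge0 (a - b).
  have h2 := sqr_ge0 (a ^+ 2 - 1); have h3 := sqr_ge0 (b ^+ 2 - 1).
  have h5 := sqr_ge0 (a ^+ 2); have h6 := sqr_ge0 (b ^+ 2).
  nra.
- have -> : EFin \o (fun x => 1 + (`|f x| ^+ 4 + `|h x| ^+ 4)) =
     (EFin \o cst 1) \+ ((EFin \o (fun x => `|f x| ^+ 4)) \+
                         (EFin \o (fun x => `|h x| ^+ 4))).
    by apply/funext => x /=; rewrite !EFinD.
  apply: integrableD => //; first exact: integrable_cstr.
  by apply: integrableD => //; apply: i4.
Qed.

Lemma integrable_fourth d (T : measurableType d) (R : realType)
    (mu : probability T R) (f : T -> R) :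
  measurable_fun setT f -> (\int[mu]_x (`|f x| ^+ 4)%:E < +oo)%E ->
  mu.-integrable setT (EFin \o f).
Proof.
move=> mf f4.
have -> : f = (fun x => f x * cst 1 x) by apply/funext => x; rewrite mulr1.
apply: integrable_mul_fourth => //.
under eq_integral do rewrite /= normr1 expr1n.
by rewrite integral_cst//= mul1e probability_setT ltry.
Qed.

(** The data that the comparison of two rows uses: centring, the second moments
    and the two moment bounds. *)
Definition row_moments (R : realType) p (mu : probability (p.-tuple R) R)
    (Sigma : 'M[R]_p) (B Q : R) : Prop :=
  [/\ forall i, (\int[mu]_z (tnth z i)%:E = 0)%E,
      forall i j, (\int[mu]_z (tnth z i * tnth z j)%:E = (Sigma i j)%:E)%E,
      forall v : 'cV[R]_p, enorm v = 1 ->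
        (\int[mu]_z (`|linear_form v z| ^+ 4)%:E <= B%:E)%E &
      forall M : 'M[R]_p, is_psd M -> opnorm M <= 1 ->
        (\int[mu]_z (`|quadratic_form M z -
           fine (\int[mu]_z' (quadratic_form M z')%:E)| ^+ 2)%:E <= Q%:E)%E].

Lemma linear_formZ (R : realType) p (c : R) (y : 'cV[R]_p) z :
  linear_form (c *: y) z = c * linear_form y z.
Proof. by rewrite /linear_form -scalemxAr mxE. Qed.

Lemma fourth_moment_scale (R : realType) p (mu : probability (p.-tuple R) R)
    (B : R) (y : 'cV[R]_p) :
  (forall v : 'cV[R]_p, enorm v = 1 ->
        (\int[mu]_z (`|linear_form v z| ^+ 4)%:E <= B%:E)%E) ->
  (\int[mu]_z (`|linear_form y z| ^+ 4)%:E <= (dot y y ^+ 2 * B)%:E)%E.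
Proof.
move=> hB; have [->|y0] := eqVneq y 0.
  under eq_integral do rewrite /linear_form mulmx0 mxE normr0 expr0n/=.
  by rewrite integral0 /dot mulmx0 mxE expr0n mul0r.
set l := Num.sqrt (dot y y).
have yy : 0 < dot y y by rewrite lt_def dot_sqr_eq0 y0 dot_sqr_ge0.
have l0 : 0 < l by rewrite sqrtr_gt0.
have l2 : l ^+ 2 = dot y y by rewrite sqr_sqrtr// ltW.
have v1 : enorm (l^-1 *: y) = 1.
  rewrite enormE dotZl dotZr -l2 mulrA -expr2 -exprMn mulVf ?gt_eqF//.
  by rewrite expr1n sqrtr1.
have -> : (\int[mu]_z (`|linear_form y z| ^+ 4)%:E =
  \int[mu]_z ((dot y y ^+ 2)%:E * (`|linear_form (l^-1 *: y) z| ^+ 4)%:E))%E.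
  apply: eq_integral => z _; rewrite -EFinM; congr (_%:E).
  rewrite linear_formZ normrM exprMn mulrA -l2.
  rewrite -exprM -[in l ^+ _](gtr0_norm l0) -exprMn -normrM mulfV ?gt_eqF//.
  by rewrite normr1 expr1n mul1r.
rewrite ge0_integralZl_EFin ?sqr_ge0//; last first.
  apply/measurable_EFinP/measurable_funX; apply: measurableT_comp => //.
  exact: measurable_linear_form.
rewrite (EFinM (dot y y ^+ 2)); apply: lee_wpmul2l; last exact: hB.
by rewrite lee_fin sqr_ge0.
Qed.

Lemma linear_form_delta (R : realType) p (i : 'I_p) (z : p.-tuple R) :
  linear_form (delta_mx i 0) z = tnth z i.
Proof.
rewrite linear_formE (bigD1 i)//= !mxE !eqxx mul1r big1 ?addr0// => j ji.
by rewrite mxE (negbTE ji) mul0r.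
Qed.

Lemma enorm_delta (R : realType) p (i : 'I_p) :
  enorm (delta_mx i 0 : 'cV[R]_p) = 1.
Proof.
rewrite /enorm (bigD1 i)//= !mxE !eqxx expr1n big1 ?addr0 ?sqrtr1// => j ji.
by rewrite mxE (negbTE ji) expr0n.
Qed.

Lemma coord_fourth (R : realType) p (mu : probability (p.-tuple R) R)
    (B : R) i :
  (forall v : 'cV[R]_p, enorm v = 1 ->
        (\int[mu]_z (`|linear_form v z| ^+ 4)%:E <= B%:E)%E) ->
  (\int[mu]_z (`|tnth z i| ^+ 4)%:E < +oo)%E.
Proof.
move=> hB; apply: le_lt_trans (ltry B).
rewrite (le_trans _ (hB _ (enorm_delta R i)))// le_eqVlt; apply/orP; left.
by apply/eqP; apply: eq_integral => z _; rewrite linear_form_delta.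
Qed.

Lemma integral_linear_form (R : realType) p (mu : probability (p.-tuple R) R)
    Sigma B Q (v : 'cV[R]_p) : row_moments mu Sigma B Q ->
  mu.-integrable setT (EFin \o linear_form v) /\
  (\int[mu]_z (linear_form v z)%:E = 0)%E.
Proof.
move=> [h1 _ hB _].
have ic i : mu.-integrable setT (fun z => (v i 0)%:E * (tnth z i)%:E)%E.
  apply: integrableZl => //.
  apply: integrable_fourth (coord_fourth i hB); exact: measurable_tnth.
have E z : (linear_form v z)%:E = (\sum_i (v i 0)%:E * (tnth z i)%:E)%E.
  by rewrite linear_formE -sumEFin; apply: eq_bigr => i _; rewrite EFinM.
split.
  rewrite (_ : _ \o _ = fun z => \sum_i (v i 0)%:E * (tnth z i)%:E)%E; last exact/funext.
  exact: integrable_sum.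
under eq_integral do rewrite E.
rewrite integral_sum//= big1// => i _.
rewrite integralZl// ?h1 ?mule0//.
apply: integrable_fourth (coord_fourth i hB); exact: measurable_tnth.
Qed.

(** The trace of [M *m N^T], written so as to match the expansion of a quadratic
    form in coordinates. *)
Definition pairing (R : realType) p (M N : 'M[R]_p) : R :=
  \sum_i \sum_j M i j * N i j.

Lemma integrable_coordM (R : realType) p (mu : probability (p.-tuple R) R)
    (B : R) i j :
  (forall v : 'cV[R]_p, enorm v = 1 ->
        (\int[mu]_z (`|linear_form v z| ^+ 4)%:E <= B%:E)%E) ->
  mu.-integrable setT (fun z => (tnth z i * tnth z j)%:E).
Proof.
move=> hB; apply: integrable_mul_fourth (coord_fourth i hB) (coord_fourth j hB);
exact: measurable_tnth.
Qed.

Lemma quadratic_form_EFin (R : realType) p (M : 'M[R]_p) :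
  EFin \o quadratic_form M =
  (fun z => \sum_i \sum_j (M i j)%:E * (tnth z i * tnth z j)%:E)%E.
Proof.
apply/funext => z; rewrite /= quadratic_formE -sumEFin; apply: eq_bigr => i _.
by rewrite -sumEFin; apply: eq_bigr => j _; rewrite EFinM.
Qed.

Lemma integrable_quadratic_form (R : realType) p
    (mu : probability (p.-tuple R) R) (B : R) (M : 'M[R]_p) :
  (forall v : 'cV[R]_p, enorm v = 1 ->
        (\int[mu]_z (`|linear_form v z| ^+ 4)%:E <= B%:E)%E) ->
  mu.-integrable setT (EFin \o quadratic_form M).
Proof.
move=> hB; rewrite quadratic_form_EFin.
apply: integrable_sum => // i _; apply: integrable_sum => // j _.
exact/integrableZl/(integrable_coordM i j hB).
Qed.

Lemma integral_quadratic_form (R : realType) p (mu : probability (p.-tuple R) R)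
    Sigma B Q (M : 'M[R]_p) : row_moments mu Sigma B Q ->
  (\int[mu]_z (quadratic_form M z)%:E = (pairing M Sigma)%:E)%E.
Proof.
move=> [_ h2 hB _].
have ic i j : mu.-integrable setT (fun z => (M i j)%:E * (tnth z i * tnth z j)%:E)%E.
  exact/integrableZl/(integrable_coordM i j hB).
transitivity (\int[mu]_z (EFin \o quadratic_form M) z)%E; first by [].
rewrite quadratic_form_EFin integral_sum//=; last first.
  by move=> i; exact: integrable_sum.
rewrite -sumEFin; apply: eq_bigr => i _.
rewrite integral_sum//= -sumEFin; apply: eq_bigr => j _.
rewrite integralZl// ?h2 ?EFinM//; exact: (integrable_coordM i j hB).
Qed.

Lemma sqr_linear_form (R : realType) p (y : 'cV[R]_p) z :
  linear_form y z ^+ 2 = quadratic_form (y *m y^T) z.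
Proof.
rewrite /linear_form /quadratic_form expr2 -mulmxA -mulmxA.
have -> : y^T *m vec z = ((vec z)^T *m y)^T by rewrite trmx_mul trmxK.
rewrite mulmxA; move: ((vec z)^T *m y) => N.
by rewrite !mxE big_ord1 mxE.
Qed.

(** * Freezing the denominator *)

Lemma inv1D_lipschitz (R : realFieldType) (x y : R) : 0 <= x -> 0 <= y ->
  `|(1 + x)^-1 - (1 + y)^-1| <= Num.min `|x - y| 1.
Proof.
move=> x0 y0; have x1 : 0 < 1 + x by rewrite ltr_pwDl.
have y1 : 0 < 1 + y by rewrite ltr_pwDl.
have ix : 0 < (1 + x)^-1 /\ (1 + x)^-1 <= 1.
  by rewrite invr_gt0 x1 invf_le1// lerDl.
have iy : 0 < (1 + y)^-1 /\ (1 + y)^-1 <= 1.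
  by rewrite invr_gt0 y1 invf_le1// lerDl.
rewrite le_min; apply/andP; split; last by rewrite ler_norml; lra.
have -> : (1 + x)^-1 - (1 + y)^-1 = (y - x) * ((1 + x)^-1 * (1 + y)^-1).
  by field; rewrite !gt_eqF.
rewrite normrM distrC ler_piMr// gtr0_norm; last by rewrite mulr_gt0; lra.
by rewrite mulr_ile1; lra.
Qed.

Lemma quadratic_form_ge0 (R : realType) p (M : 'M[R]_p) z :
  is_psd M -> 0 <= quadratic_form M z.
Proof. by move=> [_]; apply. Qed.

Lemma pairing_ge0 (R : realType) p (mu : probability (p.-tuple R) R)
    Sigma B Q (M : 'M[R]_p) : row_moments mu Sigma B Q -> is_psd M ->
  0 <= pairing M Sigma.
Proof.
move=> hmu psdM; have e := integral_quadratic_form M hmu.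
rewrite -lee_fin -e; apply: integral_ge0 => z _.
by rewrite lee_fin quadratic_form_ge0.
Qed.

(** Here [s] is the row weight over [sqrt n], [a] the entry of the test vector,
    [B] bounds fourth moments of linear forms and [Q] variances of quadratic
    forms. *)
Definition row_error (R : realType) (t s a B Q : R) : R :=
  2 * (Num.min (s ^+ 2 / t * Num.sqrt Q) 1 * (a ^+ 2 + s ^+ 2 / t * Num.sqrt B)).

(** The truncated deviation is at most 1 and at most the deviation itself, and
    the variance bound applies to the latter. *)
Lemma integral_truncated_deviation (R : realType) p
    (mu : probability (p.-tuple R) R) Sigma B Q (N : 'M[R]_p) (k : R) :
  row_moments mu Sigma B Q -> is_psd N -> opnorm N <= 1 -> 0 <= k ->
  (\int[mu]_z (Num.min `|k * quadratic_form N z - k * pairing N Sigma| 1 ^+ 2)%:E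
   <= (Num.min (k * Num.sqrt Q) 1 ^+ 2)%:E)%E.
Proof.
move=> hmu pN oN k0; have qE := integral_quadratic_form N hmu.
have [_ _ _ /(_ N pN oN)] := hmu; rewrite qE /= => hQ.
pose f (z : p.-tuple R) :=
  Num.min `|k * quadratic_form N z - k * pairing N Sigma| 1.
change (\int[mu]_z (f z ^+ 2)%:E <=
  (Num.min (k * Num.sqrt Q) 1 ^+ 2)%:E)%E.
have f0 z : 0 <= f z by rewrite /f le_min ler01 normr_ge0.
have mq : measurable_fun setT (fun z : p.-tuple R => quadratic_form N z - pairing N Sigma).
  by apply: measurable_funB => //; exact: measurable_quadratic_form.
have mf : measurable_fun setT (fun z => f z ^+ 2).
  apply/measurable_funX/measurable_minr => //; apply: measurableT_comp => //.
  under eq_fun do rewrite -mulrBr.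
  exact: measurable_funM.
have [kQ|kQ] := leP (k * Num.sqrt Q) 1; last first.
  apply: (@le_trans _ _ (\int[mu]_z (cst 1%:E) z)%E).
    apply: ge0_le_integral => //.
    - by move=> z _; rewrite lee_fin sqr_ge0.
    - exact/measurable_EFinP.
    - by move=> z _; rewrite lee_fin expr_le1// /f ge_min lexx orbT.
  by rewrite integral_cst//= probability_setT mule1 expr1n.
have Q0 : 0 <= Q.
  rewrite -lee_fin (le_trans _ hQ)//; apply: integral_ge0 => z _.
  by rewrite lee_fin exprn_ge0.
apply: (@le_trans _ _ (\int[mu]_z ((k ^+ 2)%:E *
    (`|quadratic_form N z - pairing N Sigma| ^+ 2)%:E))%E).
  apply: ge0_le_integral => //.
  - by move=> z _; rewrite lee_fin sqr_ge0.
  - exact/measurable_EFinP.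
  - under eq_fun do rewrite -EFinM.
    apply/measurable_EFinP/measurable_funM => //; apply: measurable_funX.
    exact: measurableT_comp.
  move=> z _; rewrite -EFinM lee_fin -exprMn lerXn2r ?nnegrE ?mulr_ge0//.
  by rewrite -[X in X * _](ger0_norm k0) -normrM mulrBr /f ge_min lexx.
rewrite ge0_integralZl_EFin ?sqr_ge0//; last first.
- by apply/measurable_EFinP/measurable_funX; exact: measurableT_comp.
rewrite exprMn sqr_sqrtr// (EFinM (k ^+ 2)) lee_wpmul2l// lee_fin.
exact: sqr_ge0.
Qed.

(** The constant [c] is the mean of the expression with frozen denominator; it
    only depends on the covariance, which makes the estimate usable for two
    different laws. Integrability of [phi] comes from the frozen numerator, as
    the denominator is at least 1. *)
Lemma one_row_estimate (R : realType) p (mu : probability (p.-tuple R) R)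
    Sigma B Q (N : 'M[R]_p) (y : 'cV[R]_p) (t s a : R) :
  row_moments mu Sigma B Q -> is_psd N -> opnorm N <= 1 -> 0 < t ->
  t * dot y y <= 1 ->
  let phi z := (a - s * linear_form y z) ^+ 2 /
     (1 + s ^+ 2 / t * quadratic_form N z) in
  let c := (a ^+ 2 + s ^+ 2 * pairing (y *m y^T) Sigma) /
     (1 + s ^+ 2 / t * pairing N Sigma) in
  mu.-integrable setT (EFin \o phi) /\
  (`| \int[mu]_z (phi z)%:E - c%:E | <= (row_error t s a B Q)%:E)%E.
Proof.
move=> hmu pN oN t0 ty phi c.
set k := s ^+ 2 / t in phi c *.
have k0 : 0 <= k by rewrite divr_ge0 ?sqr_ge0 ?ltW.
set qb := pairing N Sigma in c *; set cy := pairing (y *m y^T) Sigma in c *.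
have qb0 : 0 <= qb by exact: pairing_ge0 hmu pN.
have kq0 z : 0 <= k * quadratic_form N z by rewrite mulr_ge0// quadratic_form_ge0.
have kqb0 : 0 <= k * qb by rewrite mulr_ge0.
have [il il0] := integral_linear_form y hmu.
have iq : mu.-integrable setT (EFin \o quadratic_form (y *m y^T)).
  by have [_ _ hB _] := hmu; exact: integrable_quadratic_form hB.
have iqE := integral_quadratic_form (y *m y^T) hmu.
pose sq (z : p.-tuple R) := (a - s * linear_form y z) ^+ 2.
have ml := measurable_linear_form y.
have mq := measurable_quadratic_form N.
have msq : measurable_fun setT sq.
  by apply: measurable_funX; apply: measurable_funB => //; apply: measurable_funM.
have sqE : EFin \o sq = ((EFin \o cst (a ^+ 2)%R) \+
    ((fun z => (- (2 * a * s))%:E * (EFin \o linear_form y) z) \+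
     (fun z => (s ^+ 2)%:E * (EFin \o quadratic_form (y *m y^T)%R) z)))%E.
  apply/funext => z /=; rewrite -!EFinM -!EFinD -sqr_linear_form /sq; congr EFin.
  ring.
have i1 : mu.-integrable setT (fun z => (- (2 * a * s))%:E * (EFin \o linear_form y) z)%E.
  exact: integrableZl.
have i2 : mu.-integrable setT (fun z => (s ^+ 2)%:E * (EFin \o quadratic_form (y *m y^T)%R) z)%E.
  exact: integrableZl.
have isq : mu.-integrable setT (EFin \o sq).
  rewrite sqE; apply: integrableD => //; first exact: integrable_cstr.
  exact: integrableD.
have int_sq : (\int[mu]_z (sq z)%:E = (a ^+ 2 + s ^+ 2 * cy)%:E)%E.
  transitivity (\int[mu]_z (EFin \o sq) z)%E; first by [].
  rewrite sqE integralD//=; [|exact: integrable_cstr|exact: integrableD].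
  rewrite integralD// integralZl// integralZl// il0 iqE mule0 add0e.
  by rewrite integral_cst//= probability_setT mule1.
pose phi0 z := (1 + k * qb)^-1 * sq z.
have int_phi0 : (\int[mu]_z (phi0 z)%:E = c%:E)%E.
  under eq_integral do rewrite EFinM.
  by rewrite integralZl// int_sq -EFinM mulrC.
have iphi0 : mu.-integrable setT (EFin \o phi0).
  rewrite (_ : _ \o _ = fun z => ((1 + k * qb)^-1)%:E * (EFin \o sq) z)%E.
    exact: integrableZl.
  by apply/funext => z /=.
have mden : measurable_fun setT (fun z : p.-tuple R => (1 + k * quadratic_form N z)^-1).
  by apply: measurable_funV; apply: measurable_funD => //; apply: measurable_funM.
have mphi : measurable_fun setT phi by exact: measurable_funM.
have iphi : mu.-integrable setT (EFin \o phi).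
  apply: (integrable_le_EFin _ _ isq) => // z.
  rewrite /phi /sq normrM ger0_norm ?sqr_ge0// ler_piMr ?sqr_ge0//.
  by rewrite ger0_norm ?invr_ge0 ?addr_ge0// invf_le1 ?lerDl// ltr_pwDl.
split => //.
rewrite -int_phi0 -integralB_EFin//.
pose m (z : p.-tuple R) := Num.min `|k * quadratic_form N z - k * qb| 1.
have m0 z : 0 <= m z by rewrite /m le_min ler01 normr_ge0.
have mm : measurable_fun setT m.
  apply: measurable_minr => //; apply: measurableT_comp => //.
  by apply: measurable_funB => //; apply: measurable_funM.
pose b2 (z : p.-tuple R) := (s * linear_form y z) ^+ 2.
have mb2 : measurable_fun setT b2 by apply: measurable_funX; apply: measurable_funM.
have b20 z : 0 <= b2 z by exact: sqr_ge0.
have mB : measurable_fun setT (fun z => phi z - phi0 z).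
  by apply: measurable_funB => //; apply: measurable_funM.
set m_ := Num.min (k * Num.sqrt Q) 1.
set beta := k * Num.sqrt B.
have m_0 : 0 <= m_ by rewrite le_min ler01 mulr_ge0 ?sqrtr_ge0.
have beta0 : 0 <= beta by rewrite mulr_ge0 ?sqrtr_ge0.
have int_m2 : (\int[mu]_z (m z ^+ 2)%:E <= (m_ ^+ 2)%:E)%E.
  exact: integral_truncated_deviation hmu pN oN k0.
(* Cauchy-Schwarz against the constant 1 *)
have int_m : (\int[mu]_z (1 * m z)%:E <= (1 * m_)%:E)%E.
  apply: (@integral_cauchy_schwarz _ _ _ _ (cst 1) m) => //.
  under eq_integral do rewrite /= expr1n.
  by rewrite expr1n integral_cst//= probability_setT mule1.
(* [B] is only known to be nonnegative if there is a unit vector, as is the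
   case when [y] is nonzero. *)
have B0 : 0 <= B \/ y = 0.
  have [->|y0] := eqVneq y 0; [by right|left].
  have dy : 0 < dot y y by rewrite lt_def dot_sqr_eq0 y0 dot_sqr_ge0.
  have [_ _ hB _] := hmu.
  have : (0%:E <= (dot y y ^+ 2 * B)%:E)%E.
    apply: le_trans (fourth_moment_scale y hB).
    by apply: integral_ge0 => z _; rewrite lee_fin exprn_ge0.
  by rewrite lee_fin pmulr_rge0// exprn_gt0.
have int_b4 : (\int[mu]_z (b2 z ^+ 2)%:E <= (beta ^+ 2)%:E)%E.
  have [_ _ hB _] := hmu.
  have -> : (\int[mu]_z (b2 z ^+ 2)%:E =
     (s ^+ 4)%:E * \int[mu]_z (`|linear_form y z| ^+ 4)%:E)%E.
    rewrite -ge0_integralZl_EFin//; last 2 first.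
    - by apply/measurable_EFinP/measurable_funX; exact: measurableT_comp.
    - by rewrite (_ : 4%N = (2 * 2)%N)// exprM sqr_ge0.
    apply: eq_integral => z _; rewrite -EFinM; congr EFin.
    rewrite /b2 -exprM exprMn (_ : (2 * 2)%N = 4%N)//; congr (_ * _).
    by rewrite -normrX ger0_norm// (_ : 4%N = (2 * 2)%N)// exprM sqr_ge0.
  apply: (@le_trans _ _ ((s ^+ 4)%:E * (dot y y ^+ 2 * B)%:E)%E).
    apply: lee_wpmul2l; last exact: fourth_moment_scale.
    by rewrite lee_fin (_ : 4%N = (2 * 2)%N)// exprM sqr_ge0.
  rewrite -EFinM lee_fin /beta exprMn.
  case: B0 => [B0|->]; last first.
    by rewrite /dot mulmx0 mxE expr0n mul0r mulr0 mulr_ge0// sqr_ge0.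
  rewrite sqr_sqrtr// mulrA ler_wpM2r//.
  have sk : s ^+ 2 * dot y y <= k.
    by rewrite /k ler_wpM2l ?sqr_ge0// -[_^-1]mul1r ler_pdivlMr// mulrC.
  have s0 : 0 <= s ^+ 2 * dot y y by rewrite mulr_ge0 ?sqr_ge0 ?dot_sqr_ge0.
  rewrite (_ : s ^+ 4 * _ = (s ^+ 2 * dot y y) ^+ 2); last by ring.
  by rewrite ler_sqr ?nnegrE.
have int_b2m : (\int[mu]_z (b2 z * m z)%:E <= (beta * m_)%:E)%E.
  exact: integral_cauchy_schwarz.
have msum : measurable_fun setT (fun z => 2 * (a ^+ 2 * (1 * m z) + b2 z * m z)).
  apply: measurable_funM => //; apply: measurable_funD; apply: measurable_funM => //.
  exact: measurable_funM.
apply: (@le_trans _ _ (\int[mu]_z (2 * (a ^+ 2 * (1 * m z) + b2 z * m z))%:E)%E).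
  apply: (le_trans (le_abse_integral _ _ _)) => //; first exact/measurable_EFinP.
  apply: ge0_le_integral => //.
  - by apply: measurableT_comp => //; exact/measurable_EFinP.
  - exact/measurable_EFinP.
  move=> z _; rewrite /= lee_fin.
  have -> : phi z - phi0 z =
     sq z * ((1 + k * quadratic_form N z)^-1 - (1 + k * qb)^-1).
    by rewrite /phi /phi0 -/(sq z); ring.
  rewrite normrM (ger0_norm (sqr_ge0 _)).
  have h1 := inv1D_lipschitz (kq0 z) kqb0; rewrite -/(m z) in h1.
  have h2 : sq z <= 2 * (a ^+ 2 + b2 z).
    rewrite /sq /b2; move: (s * _) => b; have := sqr_ge0 (a + b); nra.
  have h3 : 0 <= sq z by exact: sqr_ge0.
  apply: (le_trans (ler_pM h3 (normr_ge0 _) h2 h1)).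
  by rewrite le_eqVlt; apply/orP; left; apply/eqP; ring.
have mm1 : measurable_fun setT (fun z => (1 * m z)%:E).
  by apply/measurable_EFinP/measurable_funM.
have mb2m : measurable_fun setT (fun z => (b2 z * m z)%:E).
  by apply/measurable_EFinP/measurable_funM.
have am0 z : (0 <= (1 * m z)%:E)%E by rewrite lee_fin mul1r.
have b2m0 z : (0 <= (b2 z * m z)%:E)%E by rewrite lee_fin mulr_ge0.
have -> : (\int[mu]_z (2 * (a ^+ 2 * (1 * m z) + b2 z * m z))%:E =
  2%:E * ((a ^+ 2)%:E * \int[mu]_z (1 * m z)%:E + \int[mu]_z (b2 z * m z)%:E))%E.
  rewrite -(@ge0_integralZl_EFin _ _ _ mu setT _ (fun z => (1 * m z)%:E))// ?sqr_ge0//.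
  rewrite -ge0_integralD//; last 2 first.
  - by move=> z _; rewrite mule_ge0// lee_fin sqr_ge0.
  - exact: measurable_funeM.
  rewrite -ge0_integralZl_EFin//.
  - by move=> z _; rewrite adde_ge0// mule_ge0// lee_fin sqr_ge0.
  - by apply: emeasurable_funD => //; exact: measurable_funeM.
rewrite /row_error -/k -/m_ -/beta.
rewrite (_ : 2 * (m_ * (a ^+ 2 + beta)) =
             2 * (a ^+ 2 * (1 * m_) + beta * m_)); last by ring.
rewrite (EFinM 2) (EFinD (a ^+ 2 * _)) (EFinM (a ^+ 2)).
apply: lee_wpmul2l => //; apply: leeD => //; apply: lee_wpmul2l => //.
by rewrite lee_fin sqr_ge0.
Qed.

(** * Dependence of [g] on one row *)

Lemma gram_row_update (R : realType) n p (V V0 : 'M[R]_(n, p)) (i : 'I_n)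
    (x : 'cV[R]_p) (alpha : 'cV[R]_n) :
  (forall j k, V j k = if j == i then x k 0 else V0 j k) ->
  (forall k, V0 i k = 0) ->
  V^T *m V = V0^T *m V0 + x *m x^T /\
  V^T *m alpha = V0^T *m alpha + alpha i 0 *: x.
Proof.
move=> VE V0i.
have off j k : j != i -> V j k = V0 j k by move=> ji; rewrite VE (negbTE ji).
split; apply/matrixP => k l.
  rewrite !mxE big_ord1 !mxE (bigD1 i)//= [in RHS](bigD1 i)//= !mxE V0i mul0r add0r.
  rewrite !VE eqxx addrC; congr (_ + _).
  by apply: eq_bigr => j ji; rewrite !mxE !off.
rewrite ord1 !mxE (bigD1 i)//= [in RHS](bigD1 i)//= !mxE V0i mul0r add0r.
rewrite VE eqxx addrC mulrC; congr (_ + _).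
by apply: eq_bigr => j ji; rewrite !mxE off.
Qed.

Lemma ridge_row_update (R : realType) n p (t : R) (A : 'M[R]_p)
    (V V0 : 'M[R]_(n, p)) (i : 'I_n) (x : 'cV[R]_p) (alpha : 'cV[R]_n) :
  0 < t -> coercive t A ->
  (forall j k, V j k = if j == i then x k 0 else V0 j k) ->
  (forall k, V0 i k = 0) ->
  let G := invmx (V0^T *m V0 + A) in
  ridge A alpha V = ridge A alpha V0 + alpha i 0 ^+ 2
   - (alpha i 0 - dot (G *m (V0^T *m alpha)) x) ^+ 2 / (1 + dot x (G *m x)).
Proof.
move=> t0 cA VE V0i G; have [e1 e2] := gram_row_update alpha VE V0i.
have cS0 := coercive_gram V0 cA; have cS := coercive_gram V cA.
have eS : V^T *m V + A = V0^T *m V0 + A + x *m x^T by rewrite e1 addrAC.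
rewrite /ridge e2 eS rank_one_update ?(coercive_unitmx t0 cS0)//.
- by rewrite -eS (coercive_unitmx t0 cS).
- exact: coercive_inv_sym cS0.
- by rewrite (le_trans _ (coercive_inv x t0 cS0))// mulr_ge0 ?dot_sqr_ge0// ltW.
Qed.

Definition set_row (R : realType) n p (w : 'I_n -> p.-tuple R) (i : 'I_n)
    (z : p.-tuple R) : 'I_n -> p.-tuple R :=
  fun j => if j == i then z else w j.

Lemma linear_form_dot (R : realType) p (y : 'cV[R]_p) z :
  linear_form y z = dot y (vec z).
Proof. by rewrite dotC. Qed.

Lemma quadratic_form_dot (R : realType) p (M : 'M[R]_p) z :
  quadratic_form M z = dot (vec z) (M *m vec z).
Proof. by rewrite /quadratic_form -mulmxA. Qed.

(** [N], [y] and [b] are computed from the data in which the row of index [i] is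
    zero: [N] is [t] times the inverse, so that the bounds on it are those of a
    test matrix in the variance bound. *)
Lemma g_set_row (R : realType) n p (r : 'rV[R]_n) (A : 'M[R]_p)
    (alpha : 'cV[R]_n) (t : R) (w : 'I_n -> p.-tuple R) (i : 'I_n) :
  0 < t -> coercive t A -> enorm alpha = 1 ->
  exists (N : 'M[R]_p) (y : 'cV[R]_p) (b : R),
    [/\ is_psd N, opnorm N <= 1, t * dot y y <= 1 &
     forall z, let s := r 0 i / Num.sqrt n%:R in
       g (diag_mx r) A alpha (rows_mx (set_row w i z)) =
       b - (alpha i 0 - s * linear_form y z) ^+ 2 /
           (1 + s ^+ 2 / t * quadratic_form N z)].
Proof.
move=> t0 cA a1.
pose V z := (Num.sqrt n%:R)^-1 *: (diag_mx r *m rows_mx (set_row w i z)).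
pose z0 : p.-tuple R := [tuple 0 | _ < p].
pose G := invmx ((V z0)^T *m V z0 + A).
pose y := G *m ((V z0)^T *m alpha).
have cS := coercive_gram (V z0) cA.
have aa : dot alpha alpha = 1.
  by rewrite -[LHS]sqr_sqrtr ?dot_sqr_ge0// -enormE a1 expr1n.
exists (t *: G), y, (ridge A alpha (V z0) + alpha i 0 ^+ 2); split.
- exact: coercive_inv_psd.
- exact: coercive_inv_opnorm.
- by have [h1 h2] := ridge_bounds alpha (V z0) t0 cA; rewrite -aa (le_trans h1).
move=> z s; rewrite g_ridge -/(V z).
have VE z' j k : V z' j k = (Num.sqrt n%:R)^-1 * (r 0 j * tnth (set_row w i z' j) k).
  by rewrite /V mul_diag_mx !mxE.
rewrite (@ridge_row_update _ _ _ t A _ (V z0) i (s *: vec z))//; last 2 first.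
- move=> j k; rewrite !VE /set_row; case: eqP => [->|//].
  by rewrite !mxE /s; ring.
- by move=> k; rewrite VE /set_row eqxx tnth_mktuple !mulr0.
rewrite -/G -/y dotZr -linear_form_dot -scalemxAr dotZl dotZr -quadratic_form_dot.
congr (_ - _ / (1 + _)).
have -> : quadratic_form (t *: G) z = t * quadratic_form G z.
  by rewrite !quadratic_form_dot -scalemxAl dotZr.
by field; rewrite gt_eqF.
Qed.

Lemma g_bounds (R : realType) n p (r : 'rV[R]_n) (A : 'M[R]_p)
    (alpha : 'cV[R]_n) (t : R) (X : 'M[R]_(n, p)) :
  0 < t -> coercive t A -> enorm alpha = 1 ->
  0 <= g (diag_mx r) A alpha X <= 1.
Proof.
move=> t0 cA a1; rewrite g_ridge; set V := _ *: _.
have aa : dot alpha alpha = 1.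
  by rewrite -[LHS]sqr_sqrtr ?dot_sqr_ge0// -enormE a1 expr1n.
have [h1 h2] := ridge_bounds alpha V t0 cA.
by rewrite -aa h2 andbT (le_trans _ h1)// mulr_ge0 ?dot_sqr_ge0// ltW.
Qed.

(** * Measurability of [g] *)

Definition measurable_mx d (T : measurableType d) (R : realType) m n
    (F : T -> 'M[R]_(m, n)) : Prop :=
  forall i j, measurable_fun setT (fun x => F x i j).

Lemma measurable_mx_cst d (T : measurableType d) (R : realType) m n
    (M : 'M[R]_(m, n)) : measurable_mx (fun _ : T => M).
Proof. by move=> i j; exact: measurable_cst. Qed.

Lemma measurable_mx_mul d (T : measurableType d) (R : realType) m n k
    (F : T -> 'M[R]_(m, n)) (H : T -> 'M[R]_(n, k)) :
  measurable_mx F -> measurable_mx H -> measurable_mx (fun x => F x *m H x).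
Proof.
move=> mF mH i j; under eq_fun do rewrite mxE.
by apply: measurable_sum => l; exact: measurable_funM.
Qed.

Lemma measurable_mx_scale d (T : measurableType d) (R : realType) m n
    (f : T -> R) (F : T -> 'M[R]_(m, n)) :
  measurable_fun setT f -> measurable_mx F ->
  measurable_mx (fun x => f x *: F x).
Proof.
by move=> mf mF i j; under eq_fun do rewrite mxE; exact: measurable_funM.
Qed.

Lemma measurable_mx_add d (T : measurableType d) (R : realType) m n
    (F H : T -> 'M[R]_(m, n)) :
  measurable_mx F -> measurable_mx H -> measurable_mx (fun x => F x + H x).
Proof.
by move=> mF mH i j; under eq_fun do rewrite mxE; exact: measurable_funD.
Qed.

Lemma measurable_mx_tr d (T : measurableType d) (R : realType) m n
    (F : T -> 'M[R]_(m, n)) :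
  measurable_mx F -> measurable_mx (fun x => (F x)^T).
Proof. by move=> mF i j; under eq_fun do rewrite mxE; exact: mF. Qed.

Lemma measurable_det d (T : measurableType d) (R : realType) m
    (F : T -> 'M[R]_m) :
  measurable_mx F -> measurable_fun setT (fun x => \det (F x)).
Proof.
move=> mF; apply: measurable_sum => s; apply: measurable_funM => //.
by apply: measurable_prod => i _; exact: mF.
Qed.

(** By Cramer's rule, the entries of the inverse are rational functions of the
    entries of the matrix. *)
Lemma measurable_mx_inv d (T : measurableType d) (R : realType) m
    (F : T -> 'M[R]_m) :
  (forall x, F x \in unitmx) -> measurable_mx F ->
  measurable_mx (fun x => invmx (F x)).
Proof.
move=> uF mF.
under eq_fun do rewrite /invmx uF.
apply: measurable_mx_scale.
  by apply: measurable_funV; exact: measurable_det.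
move=> i j; under eq_fun do rewrite mxE.
apply: measurable_funM => //; apply: measurable_det => k l.
by under eq_fun do rewrite !mxE; exact: mF.
Qed.

Lemma measurable_g d (T : measurableType d) (R : realType) n p (r : 'rV[R]_n)
    (A : 'M[R]_p) (alpha : 'cV[R]_n) (t : R) (H : T -> 'I_n -> p.-tuple R) :
  0 < t -> coercive t A -> (forall j, measurable_fun setT (H ^~ j)) ->
  measurable_fun setT (fun x => g (diag_mx r) A alpha (rows_mx (H x))).
Proof.
move=> t0 cA mH; under eq_fun do rewrite g_ridge.
pose V x := (Num.sqrt n%:R)^-1 *: (diag_mx r *m rows_mx (H x)).
have mV : measurable_mx V.
  apply: measurable_mx_scale => //; apply: measurable_mx_mul.
    exact: measurable_mx_cst.
  move=> i j; under eq_fun do rewrite mxE.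
  exact: (measurableT_comp (measurable_tnth j) (mH i)).
have mu : measurable_mx (fun x => (V x)^T *m alpha).
  apply: measurable_mx_mul; first exact: measurable_mx_tr.
  exact: measurable_mx_cst.
apply: (@measurable_mx_mul _ _ _ 1 p 1 (fun x => ((V x)^T *m alpha)^T)).
  exact: measurable_mx_tr.
apply: measurable_mx_mul => //.
apply: measurable_mx_inv.
  by move=> x; exact: coercive_unitmx t0 (coercive_gram (V x) cA).
apply: measurable_mx_add; last exact: measurable_mx_cst.
by apply: measurable_mx_mul => //; exact: measurable_mx_tr.
Qed.

(** * Exchanging the law of one row *)

(** Both means are compared with the same constant [c] of [one_row_estimate],
    since the two laws have the same covariance. *)
Lemma swap_row (R : realType) n p (r : 'rV[R]_n) (A : 'M[R]_p)
    (alpha : 'cV[R]_n) (t : R) (w : 'I_n -> p.-tuple R) (i : 'I_n)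
    (mu nu : probability (p.-tuple R) R) Sigma B Q B' Q' :
  0 < t -> coercive t A -> enorm alpha = 1 ->
  row_moments mu Sigma B Q -> row_moments nu Sigma B' Q' ->
  (\int[mu]_z (g (diag_mx r) A alpha (rows_mx (set_row w i z)))%:E <=
   \int[nu]_z (g (diag_mx r) A alpha (rows_mx (set_row w i z)))%:E +
   (row_error t (r 0 i / Num.sqrt n%:R) (alpha i 0) B Q +
    row_error t (r 0 i / Num.sqrt n%:R) (alpha i 0) B' Q')%:E)%E.
Proof.
move=> t0 cA a1 hmu hnu; set err := row_error _ _ _.
pose f z := g (diag_mx r) A alpha (rows_mx (set_row w i z)).
change (\int[mu]_z (f z)%:E <= \int[nu]_z (f z)%:E + (err B Q + err B' Q')%:E)%E.
have [N [y [b [pN oN ty fE]]]] := g_set_row r w i t0 cA a1.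
set s := r 0 i / _ in fE err *.
pose phi z := (alpha i 0 - s * linear_form y z) ^+ 2 /
     (1 + s ^+ 2 / t * quadratic_form N z).
have key (m : probability (p.-tuple R) R) : m.-integrable setT (EFin \o phi) ->
    exists2 c, (\int[m]_z (phi z)%:E)%E = c%:E & (\int[m]_z (f z)%:E)%E = (b - c)%:E.
  move=> iphi.
  have /fineK e : (\int[m]_z (phi z)%:E)%E \is a fin_num by exact: integrable_fin_num.
  exists (fine (\int[m]_z (phi z)%:E)); first by rewrite e.
  rewrite EFinB e.
  transitivity (\int[m]_z ((cst b z)%:E - (phi z)%:E))%E.
    by apply: eq_integral => z _; rewrite /f fE.
  rewrite integralB_EFin//; last exact: integrable_cstr.
  by rewrite (integral_cst m measurableT b%:E)/= probability_setT mule1.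
have [im hm] := one_row_estimate s (alpha i 0) hmu pN oN t0 ty.
have [in_ hn] := one_row_estimate s (alpha i 0) hnu pN oN t0 ty.
have [c1 e1 ->] := key _ im; have [c2 e2 ->] := key _ in_.
move: hm hn; rewrite -/phi e1 e2 -!EFinB -EFinD /= !lee_fin -/err.
rewrite !ler_norml; set c := (_ + _ * pairing _ _) / _.
move: c (err B Q) (err B' Q') => c E1 E2; lra.
Qed.

(** * Independence and iterated integration *)

Lemma g_sigma_preimage_bigcap d d' (T : measurableType d) (S : measurableType d')
    n (Z : 'I_n -> T -> S) (J : {set 'I_n}) (B : 'I_n -> set S) :
  (forall i, i \in J -> measurable (B i)) ->
  g_sigma_preimage Z (\bigcap_(i in [set` J]) (Z i @^-1` B i)).
Proof.
move=> mB.
apply: (@fin_bigcap_measurable _ (g_sigma_algebraType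
  (\big[setU/set0]_(i < n) preimage_set_system setT (Z i) measurable))) => //.
move=> i /= iJ; apply: sub_sigma_algebra.
rewrite -bigcup_seq/=; exists i => /=; first by rewrite mem_index_enum.
by exists (B i); [exact: mB|rewrite setTI].
Qed.

(** Choosing for each index one of two mutually independent families keeps the
    family independent: the chosen events of either origin form an event of the
    corresponding sigma-algebra. *)
Lemma independent_choice d d' (T : measurableType d) (S : measurableType d')
    (R : realType) (P : probability T R) n (X Y : 'I_n -> {RV P >-> S})
    (s : 'I_n -> bool) :
  independent_RVs X -> independent_RVs Y -> independent_families X Y ->
  independent_RVs (fun j => if s j then X j else Y j).
Proof.
move=> iX iY iXY J B mB.
pose JX := J :&: [set j | s j]%SET; pose JY := J :\: [set j | s j]%SET.
have mX i : i \in JX -> measurable (B i) by rewrite inE => /andP[/mB].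
have mY i : i \in JY -> measurable (B i) by rewrite inE => /andP[_ /mB].
have -> : \bigcap_(i in [set` J]) ((if s i then X i else Y i) @^-1` B i) =
   \bigcap_(i in [set` JX]) (X i @^-1` B i) `&` \bigcap_(i in [set` JY]) (Y i @^-1` B i).
  apply/seteqP; split => [w h|w [h1 h2] i /= iJ].
    split => i /=; rewrite !inE.
      by move=> /andP[iJ si]; have := h i iJ; rewrite /= si.
    by move=> /andP[si iJ]; have := h i iJ; rewrite /= (negbTE si).
  by case: ifPn => si; [apply: h1|apply: h2]; rewrite /= !inE iJ si.
rewrite iXY; [|exact: g_sigma_preimage_bigcap|exact: g_sigma_preimage_bigcap].
rewrite iX// iY// [RHS](big_setID [set j | s j]%SET)/=; congr (_ * _)%E.
  by apply: eq_bigr => i; rewrite !inE => /andP[_ ->].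
by apply: eq_bigr => i; rewrite !inE => /andP[/negbTE ->].
Qed.

Definition boxes d (S : measurableType d) n : set (set (n.-tuple S)) :=
  [set C | exists2 B : 'I_n -> set S, (forall j, measurable (B j)) &
     C = \bigcap_(j in setT) ((@tnth n S ^~ j) @^-1` B j)].
Arguments boxes {d} S n.

Lemma boxes_setI d (S : measurableType d) n : setI_closed (boxes S n).
Proof.
move=> _ _ [B mB ->] [C mC ->]; exists (fun j => B j `&` C j).
  by move=> j; exact: measurableI.
by rewrite -bigcapI; apply: eq_bigcapr.
Qed.

Lemma measurable_boxes d (S : measurableType d) n :
  @measurable _ (n.-tuple S) = <<s boxes S n >>.
Proof.
apply/seteqP; split.
  apply: smallest_sub; first exact: smallest_sigma_algebra.
  move=> C; rewrite -bigcup_seq => -[i _ [B mB <-]].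
  apply: sub_sigma_algebra; exists (fun j => if j == i then B else setT).
    by move=> j; case: ifP.
  apply/seteqP; split => [w [_ wB] j _ /=|w /(_ i Logic.I)/=].
    by case: ifPn => // /eqP ->.
  by rewrite eqxx.
apply: smallest_sub; first exact: sigma_algebra_measurable.
move=> _ [B mB ->]; apply: fin_bigcap_measurable => // j _.
by rewrite -[X in measurable X]setTI; exact: measurable_tnth.
Qed.

(** The family with the member of index [i] replaced by a constant: a tuple that
    records the values of all the other members. *)
Definition others d d' (T : measurableType d) (S : measurableType d')
    n (H : 'I_n -> T -> S) (i : 'I_n) (z : S) (w : T) : n.-tuple S :=
  [tuple if j == i then z else H j w | j < n].

Lemma measurable_others d d' (T : measurableType d) (S : measurableType d')
    n (H : 'I_n -> T -> S) (i : 'I_n) (z : S) :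
  (forall j, measurable_fun setT (H j)) ->
  measurable_fun setT (others H i z).
Proof.
move=> mH; apply/measurable_fun_tnthP => j.
rewrite /others /comp; under eq_fun do rewrite tnth_mktuple.
by case: (j == i); [exact: measurable_cst|exact: mH].
Qed.

(** Both sides are finite measures in [C] which agree on boxes, where the claim
    is the product rule; boxes are stable under intersection and generate. *)
Lemma independent_others d d' (T : measurableType d) (S : measurableType d')
    (R : realType) (P : probability T R) n (H : 'I_n -> {RV P >-> S})
    (i : 'I_n) (z : S) (B : set S) (C : set (n.-tuple S)) :
  independent_RVs H -> measurable B -> measurable C ->
  P (H i @^-1` B `&` others (fun j => H j : T -> S) i z @^-1` C) =
  (P (H i @^-1` B) * P (others (fun j => H j : T -> S) i z @^-1` C))%E.
Proof.
move=> iH mB mC; set W := others _ i z.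
have mW : measurable_fun setT W by apply: measurable_others.
have mE : measurable (H i @^-1` B).
  by rewrite -[X in measurable X]setTI; exact: measurable_funP.
set E := H i @^-1` B in mE *.
have PEfin : (fine (P E))%:E = P E by rewrite fineK// fin_num_measure.
have PE0 : 0 <= fine (P E) by rewrite fine_ge0.
pose mE1 : {measure set T -> \bar R} := mrestr P mE.
pose push (m : {measure set T -> \bar R}) :
  {measure set (n.-tuple S) -> \bar R} := pushforward m W.
pose m1 := push mW mE1.
pose m2 : {measure set (n.-tuple S) -> \bar R} := mscale (NngNum PE0) (push mW P).
have WC0 : W @^-1` [set: n.-tuple S] = setT by [].
suff : m1 C = m2 C.
  by rewrite /m1 /m2 /push /= /mscale /= /pushforward /mrestr PEfin setIC.
apply: (measure_unique (boxes S n) (fun=> setT)) => //.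
- exact: measurable_boxes.
- exact: boxes_setI.
- move=> _; exists (fun=> setT) => //.
  by apply/seteqP; split.
- by rewrite bigcup_const//; exists 0%N.
- move=> _ [D mD ->].
  rewrite /m1 /m2 /push /= /mscale /= /pushforward /mrestr PEfin preimage_bigcap.
  have WD j : W @^-1` ((@tnth n S ^~ j) @^-1` D j) =
     if j == i then [set _ | D i z] else H j @^-1` D j.
    apply/seteqP; split => w /=; rewrite /W /others tnth_mktuple;
      by case: eqP => [->|].
  under eq_bigcapr do rewrite WD.
  (* The constant coordinate either empties the preimage of the box or does not
     restrict it. *)
  have [Dz|nDz] := pselect (D i z); last first.
    have -> : \bigcap_(j in setT)
        (if j == i then [set _ | D i z] else H j @^-1` D j) = set0.
      by apply/seteqP; split => // w /(_ i Logic.I); rewrite eqxx.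
    by rewrite set0I !measure0 mule0.
  pose B1 j := if j == i then B else D j.
  have mB1 j : measurable (B1 j) by rewrite /B1; case: ifP.
  have e1 : \bigcap_(j in setT)
        (if j == i then [set _ | D i z] else H j @^-1` D j) =
     \bigcap_(j in [set` (~: [set i])%SET]) (H j @^-1` B1 j).
    apply/seteqP; split => w h j.
      by rewrite /= !inE /B1 => ji; have := h j Logic.I; rewrite (negbTE ji).
    move=> _; have := h j; rewrite /= !inE /B1.
    by case: eqVneq => [-> _|_ /(_ isT)]; [exact: Dz|exact].
  have e2 : \bigcap_(j in setT)
        (if j == i then [set _ | D i z] else H j @^-1` D j) `&` E =
     \bigcap_(j in [set` [set: 'I_n]%SET]) (H j @^-1` B1 j).
    rewrite e1; apply/seteqP; split => [w [h Ew] j _|w h].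
      have := h j; rewrite /= !inE /B1; case: eqVneq => [->//|_]; exact.
    split; first by move=> j _; apply: h; rewrite /= inE.
    by have := h i; rewrite /B1 eqxx; apply; rewrite /= inE.
  rewrite e2 e1 !iH//.
  rewrite (bigD1 i)/=; last by rewrite inE.
  rewrite (_ : H i @^-1` B1 i = E); last by rewrite /B1 eqxx.
  congr (P E * _)%E.
  by apply: eq_bigl => j; rewrite !inE.
- move=> _; rewrite /m1 /push /= /pushforward /mrestr preimage_setT setTI.
  by rewrite (le_lt_trans (probability_le1 P mE))// ltry.
Qed.

(** Independence as an iterated integral: the variable of index [i] may be
    integrated out first, the values of the others being fixed. *)
Lemma integral_independent_row d d' (T : measurableType d) (S : measurableType d')
    (R : realType) (P : probability T R) n (H : 'I_n -> {RV P >-> S})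
    (i : 'I_n) (z0 : S) (f : S * n.-tuple S -> \bar R) :
  independent_RVs H -> measurable_fun setT f -> (forall x, 0 <= f x)%E ->
  (\int[P]_w f (H i w, others (fun j => H j : T -> S) i z0 w) =
   \int[P]_w \int[distribution P (H i)]_z
      f (z, others (fun j => H j : T -> S) i z0 w))%E /\
  measurable_fun setT (fun w => \int[distribution P (H i)]_z
      f (z, others (fun j => H j : T -> S) i z0 w))%E.
Proof.
move=> iH mf f0; set W := others _ i z0.
have mW : measurable_fun setT W by apply: measurable_others.
pose WM : {mfun T >-> n.-tuple S} := HB.pack W (isMeasurableFun.Build _ _ _ _ W mW).
pose m1 : probability S R := distribution P (H i).
pose m2 : probability (n.-tuple S) R := distribution P WM.
have mp : measurable_fun setT (fun w => (H i w, W w)) by exact: measurable_fun_pair.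
pose HW : {mfun T >-> (S * n.-tuple S)%type} :=
  HB.pack (fun w => (H i w, W w)) (isMeasurableFun.Build _ _ _ _ _ mp).
pose m12 : probability (S * n.-tuple S)%type R := distribution P HW.
have mG : measurable_fun setT (fubini_G m1 f) by exact: measurable_fun_fubini_tonelli_G.
split; last first.
  exact: (measurableT_comp mG mW).
transitivity (\int[m12]_x f x)%E.
  by rewrite /m12 ge0_integral_distribution.
transitivity (\int[(m1 \x m2)%E]_x f x)%E.
  apply: eq_measure_integral => A mA _; apply/esym.
  apply: product_measure_unique => // B C mB mC.
  exact: (independent_others i z0 iH mB mC).
rewrite fubini_tonelli2// /m2 ge0_integral_distribution//.
by move=> y; apply: integral_ge0.
Qed.

(** * One step of the exchange *)

Lemma row_error_ge0 (R : realType) (t s a B Q : R) :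
  0 < t -> 0 <= row_error t s a B Q.
Proof.
move=> t0; have k0 : 0 <= s ^+ 2 / t by rewrite divr_ge0 ?sqr_ge0// ltW.
rewrite /row_error; apply: mulr_ge0 => //; apply: mulr_ge0.
  by rewrite le_min ler01 andbT mulr_ge0 ?sqrtr_ge0.
by rewrite addr_ge0 ?sqr_ge0// mulr_ge0 ?sqrtr_ge0.
Qed.

(** [H] and [H'] only differ at the index [i], so they share the tuple of the
    other rows. Once the row of index [i] has been integrated out, [swap_row]
    compares the two inner integrals for every value of that tuple. *)
Lemma lindeberg_step d (T : measurableType d) (R : realType)
    (P : probability T R) n p (H H' : 'I_n -> {RV P >-> p.-tuple R}) (i : 'I_n)
    (r : 'rV[R]_n) (A : 'M[R]_p) (alpha : 'cV[R]_n) (t : R)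
    Sigma B Q B' Q' :
  0 < t -> coercive t A -> enorm alpha = 1 ->
  independent_RVs H -> independent_RVs H' ->
  (forall j, j != i -> H j = H' j) ->
  row_moments (distribution P (H i)) Sigma B Q ->
  row_moments (distribution P (H' i)) Sigma B' Q' ->
  (\int[P]_w (g (diag_mx r) A alpha (rows_mx (fun j => H j w)))%:E <=
   \int[P]_w (g (diag_mx r) A alpha (rows_mx (fun j => H' j w)))%:E +
   (row_error t (r 0 i / Num.sqrt n%:R) (alpha i 0) B Q +
    row_error t (r 0 i / Num.sqrt n%:R) (alpha i 0) B' Q')%:E)%E.
Proof.
move=> t0 cA a1 iH iH' HH' mH mH'; set e := row_error _ _ _ _ _ + _.
have e0 : 0 <= e.
  by rewrite addr_ge0// row_error_ge0.
pose z0 : p.-tuple R := [tuple 0 | _ < p].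
pose f (x : p.-tuple R * n.-tuple (p.-tuple R)) :=
  (g (diag_mx r) A alpha (rows_mx (set_row (tnth x.2) i x.1)))%:E.
have mf : measurable_fun setT f.
  apply/measurable_EFinP; apply: (measurable_g r alpha t0 cA) => j.
  rewrite /set_row; case: (j == i); first exact: measurable_fst.
  apply: (@measurableT_comp _ _ _ _ _ _ (fun u : n.-tuple (p.-tuple R) => tnth u j)).
    exact: measurable_tnth.
  exact: measurable_snd.
have f0 x : (0 <= f x)%E.
  rewrite lee_fin; set M := rows_mx _.
  by have /andP[] := g_bounds r M t0 cA a1.
pose W := others (fun j => H j : T -> _) i z0.
have WE : W = others (fun j => H' j : T -> _) i z0.
  apply/funext => w; apply: eq_from_tnth => j; rewrite !tnth_mktuple.
  by case: eqVneq => // ji; rewrite HH'.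
have fH (G : 'I_n -> {RV P >-> p.-tuple R}) :
    (\int[P]_w (g (diag_mx r) A alpha (rows_mx (fun j => G j w)))%:E =
    \int[P]_w f (G i w, others (fun j => G j : T -> _) i z0 w))%E.
  apply: eq_integral => w _; congr (g _ _ _ (rows_mx _))%:E; apply/funext => j.
  by rewrite /set_row /= tnth_mktuple; case: eqVneq => [->|].
rewrite (fH H) (fH H').
have [-> m1] := integral_independent_row i z0 iH mf f0.
have [-> m2] := integral_independent_row i z0 iH' mf f0.
rewrite -/W -WE in m1 m2 *.
have eE : (\int[P]_w (cst e%:E) w)%E = e%:E.
  by rewrite integral_cst//= probability_setT mule1.
rewrite -eE -ge0_integralD//; last first.
  by move=> w _; apply: integral_ge0.
apply: ge0_le_integral => //.
- by move=> w _; apply: integral_ge0.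
- exact: emeasurable_funD.
move=> w _; rewrite /cst /=.
exact: (swap_row r (tnth (W w)) i t0 cA a1 mH mH').
Qed.

Lemma row_error_bound_term (R : realType) (n : nat) (t r a : R) (b q : \bar R) :
  (0 < n)%N ->
  row_error t (r / Num.sqrt n%:R) a (fine b) (fine q) =
  2 * bound_term n t r a b q.
Proof.
move=> n0; rewrite /row_error /bound_term.
have sn : 0 < Num.sqrt n%:R :> R by rewrite sqrtr_gt0 ltr0n.
have s2 : (r / Num.sqrt n%:R) ^+ 2 / t = r ^+ 2 / (n%:R * t).
  by rewrite exprMn exprVn sqr_sqrtr ?ler0n// invfM mulrA.
rewrite s2; congr (_ * (Num.min _ _ * _)).
rewrite [fine q / _]mulrC sqrtrM ?invr_ge0 ?ler0n// sqrtrV ?ler0n// mulrA.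
have -> : n%:R * t = Num.sqrt n%:R ^+ 2 * t by rewrite sqr_sqrtr ?ler0n.
by congr (_ * _); rewrite expr2 !invfM; ring.
Qed.

(** * The best moment constants of a law *)

Definition fourth_moment (R : realType) p (mu : probability (p.-tuple R) R) :
    \bar R :=
  ereal_sup [set (\int[mu]_z (`|linear_form v z| ^+ 4)%:E)%E
            | v in [set v : 'cV[R]_p | enorm v = 1]].

Definition quadratic_variance (R : realType) p
    (mu : probability (p.-tuple R) R) : \bar R :=
  ereal_sup [set (\int[mu]_z (`|quadratic_form M z -
                  fine (\int[mu]_z' (quadratic_form M z')%:E)| ^+ 2)%:E)%E
            | M in [set M : 'M[R]_p | is_psd M /\ opnorm M <= 1]].

Lemma same_law_integral d (S : measurableType d) (R : realType)
    (mu nu : probability S R) (f : S -> \bar R) :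
  same_law mu nu -> (\int[mu]_z f z = \int[nu]_z f z)%E.
Proof. by move=> h; apply: eq_measure_integral => B mB _; exact: h. Qed.

Lemma same_law_fourth_moment (R : realType) p
    (mu nu : probability (p.-tuple R) R) :
  same_law mu nu -> fourth_moment mu = fourth_moment nu.
Proof.
move=> h; congr ereal_sup; apply: eq_imagel => v _.
exact: same_law_integral.
Qed.

Lemma same_law_quadratic_variance (R : realType) p
    (mu nu : probability (p.-tuple R) R) :
  same_law mu nu -> quadratic_variance mu = quadratic_variance nu.
Proof.
move=> h; congr ereal_sup; apply: eq_imagel => M _.
by rewrite !(same_law_integral _ h).
Qed.

Lemma integral_of_distribution d d' (T : measurableType d)
    (S : measurableType d') (R : realType) (P : probability T R)
    (X : {RV P >-> S}) (f : S -> \bar R) :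
  (distribution P X).-integrable setT f ->
  P.-integrable setT (f \o X) /\
  (\int[P]_w f (X w) = \int[distribution P X]_z f z)%E.
Proof.
move=> /integrableP[mf fi].
have iX : P.-integrable setT (f \o X).
  apply/integrableP; split; first exact: measurableT_comp.
  rewrite ge0_integral_distribution in fi => //.
  exact: measurableT_comp.
by split => //; rewrite integral_distribution.
Qed.

Lemma psd0 (R : realType) p : is_psd (0 : 'M[R]_p).
Proof. by split; [rewrite trmx0|move=> v; rewrite mulmx0 mul0mx mxE]. Qed.

Lemma opnorm0_le1 (R : realType) p : opnorm (0 : 'M[R]_p) <= 1.
Proof.
have n0 (v : 'cV[R]_p) : enorm ((0 : 'M[R]_p) *m v) = 0.
  by rewrite mul0mx enormE /dot mulmx0 mxE sqrtr0.
apply: ge_sup => [|_ [v _ <-]]; last by rewrite n0.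
exists 0; exists 0; last exact: n0.
by rewrite /= enormE /dot mulmx0 mxE sqrtr0.
Qed.

(** The suprema are finite because the given bounds are, and they are
    nonnegative: there is a unit vector since [p > 0], and the zero matrix is an
    admissible test matrix. Only then are they bounds as real numbers. *)
Lemma row_moments_distribution d (T : measurableType d) (R : realType)
    (P : probability T R) p (X : {RV P >-> p.-tuple R}) Sigma
    (bL bQ2 : nat -> \bar R) :
  (0 < p)%N -> mean_zero X -> has_covariance X Sigma ->
  moment_bounds X bL bQ2 -> bL 4%N \is a fin_num -> bQ2 2%N \is a fin_num ->
  let mu := distribution P X in
  [/\ row_moments mu Sigma (fine (fourth_moment mu)) (fine (quadratic_variance mu)),
     fine (fourth_moment mu) <= fine (bL 4%N) &
     fine (quadratic_variance mu) <= fine (bQ2 2%N)].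
Proof.
move=> p0 m0 cov [hL hQ _] fL fQ mu.
have ml v : measurable_fun setT (fun z : p.-tuple R => (`|linear_form v z| ^+ 4)%:E).
  apply/measurable_EFinP/measurable_funX; apply: measurableT_comp => //.
  exact: measurable_linear_form.
have up4 : (fourth_moment mu <= bL 4%N)%E.
  apply: ge_ereal_sup => _ [v /= v1 <-].
  rewrite ge0_integral_distribution//.
  have := hL 4%N v isT v1; by rewrite unlock.
have fin4 : fourth_moment mu \is a fin_num.
  rewrite ge0_fin_numE; first by rewrite (le_lt_trans up4)// ltey_eq fL.
  pose v : 'cV[R]_p := delta_mx (Ordinal p0) 0.
  apply: (@le_trans _ _ (\int[mu]_z (`|linear_form v z| ^+ 4)%:E)%E).
    by apply: integral_ge0 => z _; rewrite lee_fin exprn_ge0.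
  by apply: ereal_sup_ubound; exists v => //=; exact: enorm_delta.
have hB v : enorm v = 1 ->
    (\int[mu]_z (`|linear_form v z| ^+ 4)%:E <= (fine (fourth_moment mu))%:E)%E.
  by move=> v1; rewrite fineK//; apply: ereal_sup_ubound; exists v.
have upQ : (quadratic_variance mu <= bQ2 2%N)%E.
  apply: ge_ereal_sup => _ [M /= [pM oM] <-].
  have iM := integrable_quadratic_form M hB.
  have [_ <-] := integral_of_distribution iM.
  rewrite ge0_integral_distribution//; last first.
    apply/measurable_EFinP/measurable_funX; apply: measurableT_comp => //.
    by apply: measurable_funB => //; exact: measurable_quadratic_form.
  have := hQ 2%N M isT pM oM; by rewrite unlock.
have finQ : quadratic_variance mu \is a fin_num.
  rewrite ge0_fin_numE; first by rewrite (le_lt_trans upQ)// ltey_eq fQ.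
  pose q0 : p.-tuple R -> R := quadratic_form 0.
  apply: (@le_trans _ _ (\int[mu]_z (`|q0 z - fine (\int[mu]_z' (q0 z')%:E)| ^+ 2)%:E)%E).
    by apply: integral_ge0 => z _; rewrite lee_fin exprn_ge0.
  apply: ereal_sup_ubound; exists 0 => //=.
  by split; [exact: psd0|exact: opnorm0_le1].
split; [split| |].
- move=> i.
  have ic : mu.-integrable setT (EFin \o (fun z => tnth z i)).
    apply: integrable_fourth (coord_fourth i hB); exact: measurable_tnth.
  have [_ <-] := integral_of_distribution ic.
  by have := m0 i; rewrite unlock.
- move=> i j.
  have [_ <-] := integral_of_distribution (integrable_coordM i j hB).
  have := cov i j; rewrite unlock !m0 /= unlock => <-.
  by apply: eq_integral => w _; rewrite -[tnth (X w) i]subr0 -[tnth (X w) j]subr0.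
- exact: hB.
- move=> M pM oM; rewrite [leRHS]fineK//; apply: ereal_sup_ubound.
  by exists M.
- exact: fine_le.
- exact: fine_le.
Qed.

(** * Lindeberg's exchange *)

Lemma integrable_g d (T : measurableType d) (R : realType)
    (P : probability T R) n p (r : 'rV[R]_n) (A : 'M[R]_p) (alpha : 'cV[R]_n)
    (t : R) (H : 'I_n -> {RV P >-> p.-tuple R}) :
  0 < t -> coercive t A -> enorm alpha = 1 ->
  P.-integrable setT
    (EFin \o (fun w => g (diag_mx r) A alpha (rows_mx (fun j => H j w)))).
Proof.
move=> t0 cA a1; apply: (integrable_le_EFin _ _ (integrable_cstr P 1)).
  exact: (measurable_g r alpha t0 cA (H := fun w j => H j w)).
move=> w; have /andP[g0 g1] := g_bounds r (rows_mx (fun j => H j w)) t0 cA a1.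
by rewrite ger0_norm.
Qed.

(** The [k]-th mixture takes its rows of index less than [k] from [X] and the
    others from [Y]; the difference of the means telescopes along these
    mixtures. *)
Lemma lindeberg d (T : measurableType d) (R : realType)
    (P : probability T R) n p (X Y : 'I_n -> {RV P >-> p.-tuple R})
    (r : 'rV[R]_n) (A : 'M[R]_p) (alpha : 'cV[R]_n) (t : R)
    (Sigma : 'I_n -> 'M[R]_p) (B Q B' Q' : 'I_n -> R) :
  0 < t -> coercive t A -> enorm alpha = 1 ->
  independent_RVs X -> independent_RVs Y -> independent_families X Y ->
  (forall i, row_moments (distribution P (X i)) (Sigma i) (B i) (Q i)) ->
  (forall i, row_moments (distribution P (Y i)) (Sigma i) (B' i) (Q' i)) ->
  (`| 'E_P[fun w => (g (diag_mx r) A alpha (rows_mx (fun i => X i w)) -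
                     g (diag_mx r) A alpha (rows_mx (fun i => Y i w)))%R] | <=
   (\sum_(i < n)
      (row_error t (r 0 i / Num.sqrt n%:R) (alpha i 0) (B i) (Q i) +
       row_error t (r 0 i / Num.sqrt n%:R) (alpha i 0) (B' i) (Q' i)))%:E)%E.
Proof.
move=> t0 cA a1 iX iY iXY mX mY.
pose err i B Q := row_error t (r 0 i / Num.sqrt n%:R) (alpha i 0) B Q.
pose H k (j : 'I_n) := if (j < k)%N then X j else Y j.
(* The mean of [g] as a real number. *)
have [G GE] : exists G : ('I_n -> {RV P >-> p.-tuple R}) -> R,
    forall Z : 'I_n -> {RV P >-> p.-tuple R},
    (\int[P]_w (g (diag_mx r) A alpha (rows_mx (fun j => Z j w)))%:E = (G Z)%:E)%E.
  exists (fun Z : 'I_n -> {RV P >-> p.-tuple R} => fine (\int[P]_w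
    (g (diag_mx r) A alpha (rows_mx (fun j => Z j w)))%:E)%E) => Z.
  by rewrite fineK//; apply: integrable_fin_num => //; exact: integrable_g t0 cA a1.
have iH k : independent_RVs (H k) by exact: independent_choice.
have -> : ('E_P[fun w => (g (diag_mx r) A alpha (rows_mx (fun i => X i w)) -
                     g (diag_mx r) A alpha (rows_mx (fun i => Y i w)))%R] =
    (G X - G Y)%:E)%E.
  rewrite EFinB -(GE X) -(GE Y) unlock.
  by rewrite integralB_EFin//; exact: integrable_g t0 cA a1.
have exchange Z Z' k S B1 Q1 B2 Q2 : independent_RVs Z -> independent_RVs Z' ->
    (forall j, j != k -> Z j = Z' j) ->
    row_moments (distribution P (Z k)) S B1 Q1 ->
    row_moments (distribution P (Z' k)) S B2 Q2 ->
    G Z <= G Z' + (err k B1 Q1 + err k B2 Q2).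
  move=> iZ iZ' ZZ' mZ mZ'; rewrite -lee_fin EFinD -(GE Z) -(GE Z').
  exact: lindeberg_step t0 cA a1 iZ iZ' ZZ' mZ mZ'.
rewrite /= lee_fin.
change (`|G X - G Y| <=
  \sum_(i < n) (err i (B i) (Q i) + err i (B' i) (Q' i))).
clearbody err; pose u k := G (H k).
have step (k : 'I_n) : `|u k.+1 - u k| <= err k (B k) (Q k) + err k (B' k) (Q' k).
  have HH j : j != k -> H k.+1 j = H k j.
    move=> jk; rewrite /H ltnS leq_eqVlt (_ : (j == k :> nat) = false)//.
    exact/negbTE.
  have HH' j : j != k -> H k j = H k.+1 j by move=> /HH.
  have Hk1 : H k.+1 k = X k by rewrite /H ltnSn.
  have Hk : H k k = Y k by rewrite /H ltnn.
  have mk1 := mX k; have mk := mY k; rewrite -Hk1 in mk1; rewrite -Hk in mk.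
  have h1 := exchange _ _ _ _ _ _ _ _ (iH k.+1) (iH k) HH mk1 mk.
  have h2 := exchange _ _ _ _ _ _ _ _ (iH k) (iH k.+1) HH' mk mk1.
  by rewrite ler_norml lerBlDl lerNl opprB lerBlDl h1 (addrC (err _ _ _)) h2.
have H0 : H 0%N = Y by apply/funext => j.
have Hn : H n = X by apply/funext => j; rewrite /H ltn_ord.
rewrite -H0 -Hn -/(u n) -/(u 0%N) -(telescope_sumr u (leq0n n)) big_mkord.
apply: (le_trans (ler_norm_sum _ _ _)).
by apply: ler_sum => k _; exact: step.
Qed.

Lemma bound_term_le (R : realType) (n : nat) (t r a : R) (b q b' q' : \bar R) :
  0 < t -> fine b <= fine b' -> fine q <= fine q' ->
  bound_term n t r a b q <= bound_term n t r a b' q'.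
Proof.
move=> t0 bb qq; rewrite /bound_term.
have c0 : 0 <= r ^+ 2 / (n%:R * t).
  by rewrite divr_ge0 ?sqr_ge0 ?mulr_ge0 ?ler0n// ltW.
have c1 : 0 <= r ^+ 2 / (Num.sqrt n%:R * t).
  by rewrite divr_ge0 ?sqr_ge0 ?mulr_ge0 ?sqrtr_ge0// ltW.
apply: ler_pM.
- by rewrite le_min ler01 andbT mulr_ge0 ?sqrtr_ge0.
- by rewrite addr_ge0 ?sqr_ge0// mulr_ge0 ?sqrtr_ge0.
- rewrite le_min !ge_min lexx orbT andbT; apply/orP; left.
  by rewrite ler_wpM2l// ler_wsqrtr// ler_wpM2r ?invr_ge0 ?ler0n.
- by rewrite lerD2l ler_wpM2l// ler_wsqrtr.
Qed.

Theorem theorem3p3 (R : realType) :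
  exists (K : R)
         (U : forall n p : nat, R -> probability (p.-tuple R) R -> R -> R -> R),
    (forall (n p : nat) (t r a : R) (mu nu : probability (p.-tuple R) R),
       same_law mu nu -> U n p t mu r a = U n p t nu r a) /\
    forall (n p : nat) (c C : R)
           (d : measure_display) (T : measurableType d) (P : probability T R)
           (X Y : 'I_n -> {RV P >-> p.-tuple R})
           (Sigma : 'I_n -> 'M[R]_p)
           (bL bQ2 : nat -> {RV P >-> p.-tuple R} -> \bar R)
           (r : 'rV[R]_n) (A : 'M[R]_p) (t : R) (alpha : 'cV[R]_n),
      0 < c -> c <= p%:R / n%:R -> p%:R / n%:R <= C ->
      independent_RVs X -> independent_RVs Y -> independent_families X Y ->
      identically_distributed X -> identically_distributed Y ->
      (forall j, mean_zero (X j) /\ mean_zero (Y j)) ->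
      (forall j, has_covariance (X j) (Sigma j) /\
                 has_covariance (Y j) (Sigma j)) ->
      (forall j, moment_bounds (X j) (bL ^~ (X j)) (bQ2 ^~ (X j)) /\
                 moment_bounds (Y j) (bL ^~ (Y j)) (bQ2 ^~ (Y j))) ->
      (forall j, [/\ bL 4%N (X j) \is a fin_num, bL 4%N (Y j) \is a fin_num,
                     bQ2 2%N (X j) \is a fin_num & bQ2 2%N (Y j) \is a fin_num]) ->
      (forall i, 0 < r 0 i) ->
      0 < t -> is_posdef A -> loewner_ge A t%:M ->
      enorm alpha = 1 ->
      [/\ (`| 'E_P[fun w => (g (diag_mx r) A alpha (rows_mx (fun i => X i w)) -
                             g (diag_mx r) A alpha (rows_mx (fun i => Y i w)))%R] |
             <= (\sum_(i < n)
                   (U n p t (distribution P (X i)) (r 0 i) (alpha i 0) +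
                    U n p t (distribution P (Y i)) (r 0 i) (alpha i 0)))%:E)%E,
          \sum_(i < n) U n p t (distribution P (X i)) (r 0 i) (alpha i 0) <=
            K * \sum_(i < n) bound_term n t (r 0 i) (alpha i 0)
                               (bL 4%N (X i)) (bQ2 2%N (X i)) &
          \sum_(i < n) U n p t (distribution P (Y i)) (r 0 i) (alpha i 0) <=
            K * \sum_(i < n) bound_term n t (r 0 i) (alpha i 0)
                               (bL 4%N (Y i)) (bQ2 2%N (Y i)) ].
Proof.
(* 2 is the factor in [row_error], from (a - b)^2 <= 2 a^2 + 2 b^2. *)
exists 2, (fun n p t mu r a =>
  2 * bound_term n t r a (fourth_moment mu) (quadratic_variance mu)).
split.
  move=> n p t r a mu nu munu.
  by rewrite (same_law_fourth_moment munu) (same_law_quadratic_variance munu).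
move=> n p c C d T P X Y Sigma bL bQ2 r A t alpha c0 cpn _ iX iY iXY _ _ m0 cov
  hb hfin _ t0 pA At a1.
have cA := loewner_coercive pA At.
(* As division by zero gives zero, the lower bound on [p / n] excludes [n = 0] and
   [p = 0]. *)
have np0 : 0 < p%:R / n%:R :> R by exact: lt_le_trans cpn.
have n0 : (0 < n)%N.
  by case: (n) np0 => //; rewrite invr0 mulr0 ltxx.
have p0 : (0 < p)%N.
  by case: (p) np0 => //; rewrite mul0r ltxx.
have dX i := row_moments_distribution p0 (m0 i).1 (cov i).1 (hb i).1
  (let: And4 h _ _ _ := hfin i in h) (let: And4 _ _ h _ := hfin i in h).
have dY i := row_moments_distribution p0 (m0 i).2 (cov i).2 (hb i).2
  (let: And4 _ h _ _ := hfin i in h) (let: And4 _ _ _ h := hfin i in h).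
have mX i := let: And3 h _ _ := dX i in h.
have mY i := let: And3 h _ _ := dY i in h.
split.
- apply: (le_trans (lindeberg r t0 cA a1 iX iY iXY mX mY)).
  rewrite lee_fin; apply: ler_sum => i _.
  by rewrite !row_error_bound_term.
- rewrite mulr_sumr; apply: ler_sum => i _; apply: ler_wpM2l => //.
  by have [_ h1 h2] := dX i; exact: bound_term_le.
- rewrite mulr_sumr; apply: ler_sum => i _; apply: ler_wpM2l => //.
  by have [_ h1 h2] := dY i; exact: bound_term_le.
Qed.
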